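(* For each $n$ let $K_n=(0,1)^n$ be the unit cube, and let $d_n(\varepsilon)$ be the supremum of all possible distances between two subsets of $K_n$ of volume $\varepsilon$. Then for every $\varepsilon\in(0,\frac12)$ $$-2\sqrt{\frac{\pi}{6}}\,\Phi^{-1}(\varepsilon)\ \le\ \liminf_{n\to\infty} d_n(\varepsilon)\ \le\ \limsup_{n\to\infty} d_n(\varepsilon)\ \le\ -2\,\Phi^{-1}(\varepsilon).$$
   Context: $\Phi(a)=\int_{-\infty}^{a}e^{-\pi x^2}\,dx$, an increasing bijection $\mathbb{R}\to(0,1)$, and $\Phi^{-1}$ is its inverse. The distance between non-empty sets $A,B$ is $\operatorname{dist}(A,B)=\inf_{x\in A,\,y\in B}\|x-y\|_2$ (Euclidean distance). Thus $d_n(\varepsilon)=\sup\{\operatorname{dist}(A,B)\}$ over Lebesgue measurable $A,B\subseteq K_n$ of volume (Lebesgue measure) exactly $\varepsilon$. *)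

(* Defs.v *)
From HB Require Import structures.
From mathcomp Require Import all_boot all_order all_algebra.
From mathcomp Require Import all_classical all_reals all_analysis.

Set Implicit Arguments.
Unset Strict Implicit.
Unset Printing Implicit Defensive.
Import Order.TTheory GRing.Theory Num.Theory.
Import numFieldNormedType.Exports.

Local Open Scope classical_set_scope.
Local Open Scope ring_scope.

Section pack_sigma_finite_measure.
Context d (T : measurableType d) (R : realType).
Variable mu : {measure set T -> \bar R}.
Hypothesis mu_sigma_finite : sigma_finite setT mu.

Let nu (_ : sigma_finite setT mu) : set T -> \bar R := mu.

Let nu0 : nu mu_sigma_finite set0 = 0%E. Proof. exact: measure0. Qed.

Let nu_ge0 A : (0 <= nu mu_sigma_finite A)%E. Proof. exact: measure_ge0. Qed.

Let nu_sigma_additive : semi_sigma_additive (nu mu_sigma_finite).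
Proof. exact: measure_semi_sigma_additive. Qed.

HB.instance Definition _ := isMeasure.Build _ _ _ (nu mu_sigma_finite)
  nu0 nu_ge0 nu_sigma_additive.

HB.instance Definition _ := Measure_isSigmaFinite.Build _ _ _
  (nu mu_sigma_finite) mu_sigma_finite.

Lemma sigma_finite_measureP :
  exists m : {sigma_finite_measure set T -> \bar R},
    m = mu :> (set T -> \bar R).
Proof. by exists (nu mu_sigma_finite). Qed.

End pack_sigma_finite_measure.

Section product_lebesgue.
Context {R : realType}.

Definition tuple_cons n (p : measurableTypeR R * n.-tuple R) : n.+1.-tuple R :=
  [tuple of p.1 :: p.2].

(* R^n is n.-tuple R, as row vectors carry no measurable structure.  This is the
   n-fold product of the one-dimensional Lebesgue measure, on the product
   sigma-algebra of n.-tuple R (the Borel sets of R^n). *)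
Fixpoint lebesgue_prod n : set (n.-tuple R) -> \bar R :=
  match n with
  | 0%N => \d_([tuple] : 0.-tuple R)
  | m.+1 =>
      pushforward (lebesgue_measure \x @lebesgue_prod m)%E (@tuple_cons m)
  end.

Lemma measurable_tuple_cons n : measurable_fun setT (@tuple_cons n).
Proof.
exact: (@measurable_cons _ _ _ R (fun p : measurableTypeR R * n.-tuple R => p.1)
  n (fun p => p.2) measurable_fst measurable_snd).
Qed.

Lemma lebesgue_prod_sigma_finite_measure n :
  exists m : {sigma_finite_measure set (n.-tuple R) -> \bar R},
    m = @lebesgue_prod n :> (set (n.-tuple R) -> \bar R).
Proof.
elim: n => [|n [m mE]]; first by exists \d_([tuple] : 0.-tuple R).
pose uncons (x : n.+1.-tuple R) : measurableTypeR R * n.-tuple R :=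
  (thead x, [tuple of behead x]).
have consK : cancel (@tuple_cons n) uncons.
  by case=> a t; congr pair; apply/val_inj.
have unconsK : cancel uncons (@tuple_cons n).
  by move=> x; rewrite [RHS]tuple_eta; apply/val_inj.
have muncons : measurable_fun setT uncons.
  apply/measurable_fun_pairP; split; last exact: measurable_behead.
  exact: (@measurable_tnth _ R n.+1 ord0).
pose pm := [the {measure set (measurableTypeR R * n.-tuple R)%type -> \bar R} of
  (lebesgue_measure \x m)%E].
have pm_sf : sigma_finite setT pm.
  have /sigma_finiteP[F [TF ndF Foo]] := sigma_finiteT (@lebesgue_measure R).
  have /sigma_finiteP[G [TG ndG Goo]] := sigma_finiteT m.
  exists (fun k => F k `*` G k).
    rewrite -setXTT TF TG predeqE => -[x y]; split => [[/= [k _ Fx] [l _ Gy]]|].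
      exists (maxn k l) => //; split.
        by move: x Fx; exact/subsetPset/ndF/leq_maxl.
      by move: y Gy; exact/subsetPset/ndG/leq_maxr.
    by move=> [k _ []/= ? ?]; split; exists k.
  move=> k; have [? ?] := Foo k; have [? ?] := Goo k.
  split; first exact: measurableX.
  by rewrite /pm/= product_measure1E// lte_mul_pinfty// ge0_fin_numE.
pose mu : {measure set (n.+1.-tuple R) -> \bar R} :=
  measure_function_pushforward__canonical__measure_function_Measure pm
    (@measurable_tuple_cons n).
have [F FT Foo] := pm_sf.
have sf : sigma_finite setT mu.
  exists (fun k => uncons @^-1` F k).
    by rewrite -preimage_bigcup -FT preimage_setT.
  move=> k; have [mF Fk] := Foo k; split.
    by rewrite -[X in measurable X]setTI; exact: muncons.
  rewrite /mu /= /pushforward (_ : _ @^-1` _ = F k)//.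
  by apply/seteqP; split => p; rewrite /preimage/= -/(tuple_cons _) consK.
by have [sm smE] := sigma_finite_measureP sf; exists sm; rewrite smE /= -mE.
Qed.

Let lebesgue_prod0 n : @lebesgue_prod n set0 = 0%E.
Proof.
by have [m <-] := lebesgue_prod_sigma_finite_measure n; exact: measure0.
Qed.

Let lebesgue_prod_ge0 n A : (0 <= @lebesgue_prod n A)%E.
Proof.
by have [m <-] := lebesgue_prod_sigma_finite_measure n; exact: measure_ge0.
Qed.

Let lebesgue_prod_sigma_additive n : semi_sigma_additive (@lebesgue_prod n).
Proof.
have [m <-] := lebesgue_prod_sigma_finite_measure n.
exact: measure_semi_sigma_additive.
Qed.

HB.instance Definition _ n := isMeasure.Build _ _ _ (@lebesgue_prod n)
  (lebesgue_prod0 n) (@lebesgue_prod_ge0 n) (@lebesgue_prod_sigma_additive n).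

Let lebesgue_prod_sigma_finite n : sigma_finite setT (@lebesgue_prod n).
Proof.
by have [m <-] := lebesgue_prod_sigma_finite_measure n; exact: sigma_finiteT.
Qed.

HB.instance Definition _ n := Measure_isSigmaFinite.Build _ _ _
  (@lebesgue_prod n) (@lebesgue_prod_sigma_finite n).

Lemma lebesgue_prod_box n (A : 'I_n -> set R) :
  (forall i, measurable (A i)) ->
  lebesgue_prod [set x : n.-tuple R | forall i, A i (tnth x i)] =
  (\prod_(i < n) lebesgue_measure (A i))%E.
Proof.
elim: n A => [A _|n IH A mA].
  by rewrite big_ord0 /= diracE mem_set// => -[].
rewrite big_ord_recl -IH; last by move=> i; exact: mA.
pose B : set (n.-tuple R) := [set x | forall i, A (lift ord0 i) (tnth x i)].
have mB : measurable B.
  rewrite (_ : B = \bigcap_(i in [set: 'I_n])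
      ((@tnth n R)^~ i @^-1` A (lift ord0 i))); last first.
    by apply/seteqP; split => x /= h i => [_|]; exact: h.
  apply: fin_bigcap_measurable => // i _.
  by rewrite -[X in measurable X]setTI; exact: measurable_tnth.
rewrite -(product_measure1E lebesgue_measure (@lebesgue_prod n) (mA ord0) mB).
rewrite /= /pushforward; congr (product_measure1 _ _ _).
apply/seteqP; split => [[a t] /= h|[a t] /= [h0 h] i].
  by split => [|i]; [exact: (h ord0)|have := h (lift ord0 i); rewrite tnthS].
by have [j ->|->] := unliftP ord0 i; [rewrite tnthS; exact: h|].
Qed.

(* Lebesgue measurable subsets of R^n and their volume: the Caratheodory
   completion of the product measure, as completed_lebesgue_measure does for
   n = 1. *)
Definition lebesgue_measurable n (A : set (n.-tuple R)) : Prop :=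
  ((@lebesgue_prod n)^*)%mu.-cara.-measurable A.

Definition volume n (A : set (n.-tuple R)) : \bar R :=
  @completed_measure_extension _ _ _ (@lebesgue_prod n) A.

Lemma lebesgue_measurable_borel n (A : set (n.-tuple R)) :
  measurable A -> lebesgue_measurable A /\ volume A = lebesgue_prod A.
Proof.
move=> mA; split; first by apply: sub_caratheodory; exact: sub_sigma_algebra.
exact: measurable_mu_extE.
Qed.

End product_lebesgue.

Section distance.
Context {R : realType}.

Definition euclidean_dist n (x y : n.-tuple R) : R :=
  Num.sqrt (\sum_(i < n) (tnth x i - tnth y i) ^+ 2).

Definition set_dist n (A B : set (n.-tuple R)) : \bar R :=
  ereal_inf [set (euclidean_dist p.1 p.2)%:E | p in A `*` B].

Definition unit_cube n : set (n.-tuple R) :=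
  [set x | forall i, 0 < tnth x i < 1].

(* The supremum is taken in \bar R; it is -oo in the degenerate dimension
   n = 0, where no subset of the cube has volume eps in ]0, 1/2[. *)
Definition cube_dist (eps : R) n : \bar R :=
  ereal_sup [set set_dist AB.1 AB.2 | AB in
    [set AB : set (n.-tuple R) * set (n.-tuple R) |
      [/\ AB.1 `<=` @unit_cube n, AB.2 `<=` @unit_cube n,
          lebesgue_measurable AB.1, lebesgue_measurable AB.2 &
          volume AB.1 = eps%:E /\ volume AB.2 = eps%:E]]].

Definition Phi (a : R) : R :=
  \int[lebesgue_measure]_(x in `]-oo, a]) expR (- (pi * x ^+ 2)).

(* Phi is a bijection from R to ]0, 1[; outside ]0, 1[ its inverse takes the
   default value 0. *)
Definition Phi_inv : R -> R := 'pinv_(fun=> 0) [set: R] Phi.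

End distance.

(* Main.v *)
From HB Require Import structures.
Require Import Defs.
From mathcomp Require Import all_boot all_order all_algebra.
From mathcomp Require Import all_classical all_reals all_analysis.
From mathcomp Require Import measurable_realfun zify ring lra.
Import Order.TTheory GRing.Theory Num.Theory.
Import numFieldNormedType.Exports.
Set Implicit Arguments.
Unset Strict Implicit.
Unset Printing Implicit Defensive.
Local Open Scope classical_set_scope.
Local Open Scope ring_scope.

(** Write phi x = exp (- pi x^2) and let J = phi o Phi_inv be the Gaussian
    isoperimetric profile.

    Upper bound. It holds in every dimension, and it is Gaussian isoperimetry carried
    to the cube by the 1-Lipschitz map Phi; here the Gaussian measure never appears,
    because the cube is approximated directly by coin tosses. Bobkov's two-point
    inequality [bobkov_two_point] tensorizes ([bin_prod_bobkov], [binomial_bobkov]):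
    a function f with values in ]0, 1[ of n binomial counts satisfies
    J (E f) <= E sqrt (J(f)^2 + energy of f). Cut [0, 1] into intervals whose lengths
    are the binomial weights 'C(N, k) / 2^N. Then cells of the product partition have
    as volume exactly their binomial probability, and the largest weight w satisfies
    N w^2 <= 2 / pi ([central_bin_le]), so that the energy of a smooth function on the
    cube is at most its squared gradient, up to an error that vanishes with w.
    If A and B are at distance d, let rho be a smooth function with gradient at most 1
    close to the distance to A ([soft_dist]) and M c = E (Phi (lambda (c - rho))).
    Bobkov's inequality for this function says that c |-> Phi_inv (M c) has slope at
    least lambda / sqrt (1 + lambda^2), up to a small error ([level_growth]). For large
    lambda, M c is at least about the volume of A for small positive c, and 1 - M c is
    at least about the volume of B for c slightly below d; hence
    d <= - 2 Phi_inv eps ([separated_sets_le]).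

    Lower bound. The half-cubes where the sum of the x_i - 1 / 2 is at most
    - s sqrt n, respectively at least s sqrt n, are at distance at least 2 s by
    Cauchy-Schwarz ([half_cube_dist]). By Lindeberg's method, replacing the uniform
    variables one at a time by the heat flow ([uniform_step], [half_cube_ge]), their
    volumes are in the limit at least Phi (- s / sqrt (pi / 6)); this exceeds eps as
    soon as s < - sqrt (pi / 6) Phi_inv eps, and a subset of volume exactly eps is cut out by
    a hyperplane ([subset_of_measure]). *)

(** * The function Phi and its inverse *)

Section calculus.
Context {R : realType}.
Implicit Types (f df : R -> R) (a b x : R).

Lemma is_derive_continuous f x d : is_derive x 1 f d -> {for x, continuous f}.
Proof.
by move=> h; apply: differentiable_continuous; apply/derivable1_diffP; case: h.
Qed.

Lemma MVT_closed f df a b : a <= b ->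
  (forall x, a <= x <= b -> is_derive x 1 f (df x)) ->
  exists2 c, a <= c <= b & f b - f a = df c * (b - a).
Proof.
move=> ab dfE.
have [||c cab ->] := @MVT_segment R f df a b ab.
- by move=> x; rewrite in_itv /= => /andP[/ltW ax /ltW xb]; apply: dfE; rewrite ax.
- apply: derivable_within_continuous => x; rewrite in_itv /= => xab.
  by case: (dfE x xab).
by exists c => //; move: cab; rewrite in_itv.
Qed.

Lemma MVT_between f df a b :
  (forall x : R, a <= x <= b \/ b <= x <= a -> is_derive x 1 f (df x)) ->
  exists2 c, (a <= c <= b \/ b <= c <= a) & f b - f a = df c * (b - a).
Proof.
move=> d; have [ab|/ltW ba] := leP a b.
  have [|c cab e] := MVT_closed (f := f) (df := df) ab; first by move=> x h; apply: d; left.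
  by exists c => //; left.
have [|c cab e] := MVT_closed (f := f) (df := df) ba; first by move=> x h; apply: d; right.
by exists c; [right|rewrite -opprB e -mulrN opprB].
Qed.

Lemma between_abs a b c : (a <= c <= b \/ b <= c <= a) -> `|c - a| <= `|b - a|.
Proof.
case=> /andP[h1 h2]; first by rewrite !ger0_norm ?subr_ge0 ?lerD2r // (le_trans h1).
by rewrite !ler0_norm ?subr_le0 ?(le_trans h1) // !opprB lerD2l lerN2.
Qed.

Lemma derive_ge0_le f df a b : a <= b ->
  (forall x, a <= x <= b -> is_derive x 1 f (df x)) ->
  (forall x, a <= x <= b -> 0 <= df x) -> f a <= f b.
Proof.
move=> ab d h; have [c cab e] := MVT_closed ab d.
by rewrite -subr_ge0 e mulr_ge0 ?h// subr_ge0.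
Qed.

End calculus.

Section Phi_theory.
Context {R : realType}.
Implicit Types x y a : R.

Definition phi x : R := expR (- (pi * x ^+ 2)).

Lemma phi_gt0 x : 0 < phi x. Proof. exact: expR_gt0. Qed.

Lemma phiN x : phi (- x) = phi x. Proof. by rewrite /phi sqrrN. Qed.

Lemma is_derive_phi x : is_derive x 1 phi (- (2 * pi * x) * phi x).
Proof.
rewrite /phi; apply: is_derive_eq.
rewrite /GRing.scale/=.
ring.
Qed.

Lemma continuous_phi : continuous phi.
Proof. by move=> x; exact: is_derive_continuous (is_derive_phi x). Qed.

Let s0 : R := (Num.sqrt (2 * pi))^-1.

Let s0_neq0 : s0 != 0.
Proof. by rewrite invr_eq0 sqrtr_eq0 -ltNge mulr_gt0 ?pi_gt0. Qed.

Lemma phi_normal_pdf : phi = normal_pdf 0 s0.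
Proof.
apply/funext => x; rewrite normal_pdfE // /normal_peak /normal_fun subr0.
have pi0 : 0 < 2 * pi :> R by rewrite mulr_gt0 ?pi_gt0.
have -> : s0 ^+ 2 = (2 * pi)^-1 by rewrite exprVn sqr_sqrtr // ltW.
have -> : (2 * pi)^-1 * pi *+ 2 = 1 :> R.
  by rewrite -mulrnAr -(mulr_natl pi 2) mulVf // gt_eqF.
rewrite sqrtr1 invr1 mul1r; congr expR.
have p : pi != 0 :> R by rewrite gt_eqF ?pi_gt0.
by rewrite -mulr_natl; move: (pi : R) p => q q0; field.
Qed.

Lemma integrable_phi (A : set R) : measurable A ->
  (@lebesgue_measure R).-integrable A (EFin \o phi).
Proof.
move=> mA; apply: (@integrableS _ _ _ lebesgue_measure setT) => //.
by rewrite phi_normal_pdf; exact: integrable_normal_pdf.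
Qed.

Lemma integral_phi : (\int[lebesgue_measure]_x (phi x)%:E = 1%:E)%E.
Proof. by rewrite phi_normal_pdf; exact: integral_normal_pdf. Qed.

Lemma PhiE a :
  (\int[lebesgue_measure]_(x in `]-oo, a]) (phi x)%:E)%E = (Phi a)%:E.
Proof.
rewrite /Phi /Rintegral fineK //.
by apply: integrable_fin_num => //; exact: integrable_phi.
Qed.

Lemma is_derive_Phi x : is_derive x 1 Phi (phi x).
Proof.
have [||||d e] := @continuous_FTC1 R phi -oo%O x (x + 1).
- by rewrite ltrDl.
- exact: integrable_phi.
- exact: ltNyr.
- exact: continuous_phi.
by split; [exact: d|rewrite -derive1E].
Qed.

Lemma continuous_Phi : continuous (@Phi R).
Proof. by move=> x; exact: is_derive_continuous (is_derive_Phi x). Qed.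

Lemma PhiN a : Phi (- a) = 1 - Phi a.
Proof.
apply/eqP; rewrite eq_sym subr_eq; apply/eqP; apply: EFin_inj.
rewrite -integral_phi EFinD -!PhiE.
rewrite (@ge0_integration_by_substitutionNy _ phi) ; first last.
- by move=> x _; exact/ltW/phi_gt0.
- by apply: continuous_subspaceT => x; exact: continuous_phi.
rewrite (_ : setT = `]-oo, a[ `|` `[a, +oo[); last first.
  apply/seteqP; split => // x _ /=; rewrite !in_itv /= andbT.
  by case: (leP a x); [right|left].
have mphi : measurable_fun setT phi.
  exact: continuous_measurable_fun continuous_phi.
rewrite ge0_integral_setU //=; first last.
- apply/disj_set2P; apply/seteqP; split => // x []/=; rewrite !in_itv /= andbT.
  by move=> xa ax; move: (lt_le_trans xa ax); rewrite ltxx.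
- by move=> x _; rewrite lee_fin ltW ?phi_gt0.
- by apply/measurable_EFinP; exact: measurable_funTS.
rewrite addeC integral_itv_bndo_bndc; last first.
  by apply/measurable_EFinP; exact: measurable_funTS.
by congr (_ + _)%E; apply: eq_integral => x _; rewrite phiN.
Qed.

Lemma Phi0 : Phi 0 = 2^-1 :> R.
Proof. have := PhiN 0; rewrite oppr0; lra. Qed.

Lemma Phi_lt : {homo @Phi R : x y / x < y}.
Proof.
move=> x y xy; rewrite -subr_gt0.
have [|c _ ->] := @MVT_closed R Phi phi x y (ltW xy).
  by move=> z _; exact: is_derive_Phi.
by rewrite mulr_gt0 ?phi_gt0 ?subr_gt0.
Qed.

Lemma Phi_mono : {mono @Phi R : x y / x <= y}.
Proof. exact: le_mono Phi_lt. Qed.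

Lemma Phi_ge0 x : 0 <= Phi x.
Proof. by apply: Rintegral_ge0 => y _; exact/ltW/phi_gt0. Qed.

Lemma Phi_gt0 x : 0 < Phi x.
Proof. by apply: le_lt_trans (Phi_ge0 (x - 1)) (Phi_lt _); rewrite ltrBlDr ltrDl. Qed.

Lemma Phi_lt1 x : Phi x < 1.
Proof. by rewrite -subr_gt0 -PhiN Phi_gt0. Qed.


Let idR : measurableTypeR R -> R := idfun.

#[local] HB.instance Definition _ :=
  @isMeasurableFun.Build _ _ _ _ idR (@measurable_id _ _ setT).

Let cdf_Phi :
  cdf (idR : {RV (normal_prob 0 s0) >-> R}) = (fun x => (Phi x)%:E).
Proof.
by apply/funext => x; rewrite -PhiE /cdf /distribution /pushforward /= /normal_prob phi_normal_pdf.
Qed.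

(** The distribution function of a probability law tends to 0 at minus infinity. *)
Lemma Phi_small y : 0 < y -> exists x, Phi x < y.
Proof.
move=> y0.
have := @cvg_cdfNy0 _ _ R _ (idR : {RV (normal_prob 0 s0) >-> R}).
rewrite cdf_Phi => /fine_cvgP[_] /cvgrPdist_lt /(_ _ y0) [M [_ MP]].
exists (M - 1).
have := MP (M - 1); rewrite ltrBlDr ltrDl ltr01 => /(_ isT) /=.
by rewrite sub0r normrN ger0_norm ?Phi_ge0.
Qed.

Lemma Phi_onto y : 0 < y < 1 -> exists x, Phi x = y.
Proof.
move=> /andP[y0 y1].
have [a ay] := Phi_small y0.
have [|b by1] := @Phi_small (1 - y); first by rewrite subr_gt0.
have yb : y < Phi (- b) by rewrite PhiN; lra.
have ab : a <= - b by rewrite ltW // -(leW_mono Phi_mono) (lt_trans ay).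
have [|||c _ <-] := @IVT R Phi a (- b) y; last by exists c.
- by [].
- by apply: continuous_subspaceT => x; exact: continuous_Phi.
- by rewrite ge_min le_max (ltW ay) (ltW yb) orbT.
Qed.

Lemma PhiK : cancel Phi (@Phi_inv R).
Proof.
by move=> x; rewrite /Phi_inv pinvKV ?inE // => a b _ _ /(inc_inj Phi_mono).
Qed.

Lemma Phi_invK y : 0 < y < 1 -> Phi (Phi_inv y) = y.
Proof. by move=> /Phi_onto[x <-]; rewrite PhiK. Qed.

Lemma Phi_inv_le x y : 0 < x < 1 -> 0 < y < 1 ->
  (Phi_inv x <= Phi_inv y) = (x <= y).
Proof. by move=> hx hy; rewrite -Phi_mono !Phi_invK. Qed.

Lemma Phi_inv_half : Phi_inv 2^-1 = 0 :> R.
Proof. by rewrite -Phi0 PhiK. Qed.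

Lemma Phi_invN y : 0 < y < 1 -> Phi_inv (1 - y) = - Phi_inv y.
Proof. by move=> /Phi_onto[x <-]; rewrite -PhiN !PhiK. Qed.

Lemma is_derive_Phi_inv y : 0 < y < 1 ->
  is_derive y 1 Phi_inv (phi (Phi_inv y))^-1.
Proof.
move=> hy; rewrite -{1}(Phi_invK hy); apply: is_derive_inverse.
- by near=> x; exact: PhiK.
- by near=> x; exact: continuous_Phi.
- exact: is_derive_Phi.
- by rewrite gt_eqF ?phi_gt0.
Unshelve. all: by end_near. Qed.

Lemma phi_le1 x : phi x <= 1.
Proof. by rewrite /phi -expR0 ler_expR oppr_le0 mulr_ge0 ?pi_ge0 ?sqr_ge0. Qed.

End Phi_theory.

(** * Bobkov's two-point inequality *)

Section two_point.
Context {R : realType}.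
Implicit Types a b c x y t : R.

(** The density at its end point of the half-line of Gaussian mass y *)
Definition profile y : R := phi (Phi_inv y).

Local Notation J := profile.
Local Notation v := (@Phi_inv R).

Lemma profile_gt0 y : 0 < J y. Proof. exact: phi_gt0. Qed.

Lemma profile_sym y : 0 < y < 1 -> J (1 - y) = J y.
Proof. by move=> hy; rewrite /J Phi_invN// phiN. Qed.

Lemma is_derive_profile y : 0 < y < 1 -> is_derive y 1 J (- (2 * pi * v y)).
Proof.
move=> hy.
have h : is_derive y 1 (phi \o v) (- (2 * pi * v y) * phi (v y) * (phi (v y))^-1).
  exact: is_derive1_comp (is_derive_phi _) (is_derive_Phi_inv hy).
by apply: is_derive_eq h _; rewrite mulfK // gt_eqF ?phi_gt0.
Qed.

Let is_derive_shift (f : R -> R) c x d : is_derive (c + x) 1 f d ->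
  is_derive x 1 (fun x => f (c + x)) d.
Proof.
move=> h; have -> : (fun x => f (c + x)) = f \o (fun x => c + x) by [].
rewrite -[d]mulr1; apply: is_derive1_comp => //.
by apply: is_derive_eq; ring.
Qed.

Let is_derive_reflect (f : R -> R) c x d : is_derive (c - x) 1 f d ->
  is_derive x 1 (fun x => f (c - x)) (- d).
Proof.
move=> h; have -> : (fun x => f (c - x)) = f \o (fun x => c - x) by [].
rewrite -mulrN1; apply: is_derive1_comp => //.
by apply: is_derive_eq; ring.
Qed.

Lemma is_derive_Phi_inv_sqr y : 0 < y < 1 ->
  is_derive y 1 (fun y => v y ^+ 2) (2 * (v y / J y)).
Proof.
move=> hy; have h := is_derive_Phi_inv hy.
by apply: is_derive_eq; rewrite /GRing.scale/= /J; ring.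
Qed.

Lemma is_derive_profile_sqr y : 0 < y < 1 ->
  is_derive y 1 (fun y => J y ^+ 2) (- (4 * pi * (v y * J y))).
Proof.
move=> hy; have h := is_derive_profile hy.
by apply: is_derive_eq; rewrite /GRing.scale/=; ring.
Qed.

Lemma is_derive_Phi_inv_profile y : 0 < y < 1 ->
  is_derive y 1 (fun y => v y * J y) (1 - 2 * pi * v y ^+ 2).
Proof.
move=> hy; have h := is_derive_profile hy; have h' := is_derive_Phi_inv hy.
apply: is_derive_eq; rewrite /GRing.scale/= mulfV ?gt_eqF ?profile_gt0 //.
by rewrite addrC; ring.
Qed.

Let ratio_mono : {homo (fun t : R => t / phi t) : s t / s <= t}.
Proof.
move=> s t st.
have e u : u / phi u = u * expR (pi * u ^+ 2) by rewrite /phi expRN invrK.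
rewrite !e.
apply: (@derive_ge0_le R (fun u => u * expR (pi * u ^+ 2))
  (fun u => expR (pi * u ^+ 2) * (1 + 2 * pi * u ^+ 2)) s t st).
  by move=> u _; apply: is_derive_eq; rewrite /GRing.scale/=; ring.
move=> u _; apply: mulr_ge0; first exact: expR_ge0.
by rewrite addr_ge0 ?(mulr_ge0 (mulr_ge0 _ (pi_ge0 R))) ?sqr_ge0.
Qed.

(** The derivative of the square of Phi_inv is 2 Phi_inv / J, and t / phi t increases. *)
Let Phi_inv_sqr_convex c x : 0 <= x -> 0 < c - x -> c + x < 1 ->
  2 * v c ^+ 2 <= v (c + x) ^+ 2 + v (c - x) ^+ 2.
Proof.
move=> x0 cx0 cx1.
have := @derive_ge0_le R (fun t => v (c + t) ^+ 2 + v (c - t) ^+ 2)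
  (fun t => 2 * (v (c + t) / J (c + t)) - 2 * (v (c - t) / J (c - t))) 0 x x0.
rewrite addr0 subr0 (_ : v c ^+ 2 + _ = 2 * v c ^+ 2); last by ring.
apply => t /andP[t0 tx].
  have hp : 0 < c + t < 1 by clear -x0 cx0 cx1 t0 tx; lra.
  have hm : 0 < c - t < 1 by clear -x0 cx0 cx1 t0 tx; lra.
  have h1 := is_derive_shift (f := fun y => v y ^+ 2) (c := c) (x := t)
    (is_derive_Phi_inv_sqr hp).
  have h2 := is_derive_reflect (f := fun y => v y ^+ 2) (c := c) (x := t)
    (is_derive_Phi_inv_sqr hm).
  exact: is_deriveD.
rewrite -mulrBr mulr_ge0 // subr_ge0; apply: ratio_mono.
rewrite Phi_inv_le; lra.
Qed.

(** J^2 has second derivative 2 (2 pi Phi_inv)^2 - 4 pi, so that, once 4 pi x^2 is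
    added, the symmetric second difference of J^2 is governed by the convexity of
    Phi_inv^2. *)
Let profile_sqr_even c x : 0 <= x -> 0 < c - x -> c + x < 1 ->
  2 * J c ^+ 2 + 8 * pi ^+ 2 * v c ^+ 2 * x ^+ 2 <=
  J (c + x) ^+ 2 + J (c - x) ^+ 2 + 4 * pi * x ^+ 2.
Proof.
move=> x0 cx0 cx1.
pose E1 t := - (4 * pi * (v (c + t) * J (c + t))) + 4 * pi * (v (c - t) * J (c - t))
  + 8 * pi * t - 16 * pi ^+ 2 * v c ^+ 2 * t.
have E10 : E1 0 = 0 by rewrite /E1 addr0 subr0; ring.
have E1_ge0 t : 0 <= t <= x -> 0 <= E1 t.
  move=> /andP[t0 tx].
  have := @derive_ge0_le R E1
    (fun t => 8 * pi ^+ 2 * (v (c + t) ^+ 2 + v (c - t) ^+ 2 - 2 * v c ^+ 2)) 0 t t0.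
  rewrite E10; apply => u /andP[u0 ut].
    have hp : 0 < c + u < 1 by clear -x0 cx0 cx1 t0 tx u0 ut; lra.
    have hm : 0 < c - u < 1 by clear -x0 cx0 cx1 t0 tx u0 ut; lra.
    have h1 := is_derive_shift (f := fun y => v y * J y) (c := c) (x := u)
      (is_derive_Phi_inv_profile hp).
    have h2 := is_derive_reflect (f := fun y => v y * J y) (c := c) (x := u)
      (is_derive_Phi_inv_profile hm).
    rewrite /E1; apply: is_derive_eq; rewrite /GRing.scale/=; ring.
  apply: mulr_ge0; first by rewrite mulr_ge0 ?sqr_ge0.
  rewrite subr_ge0.
  by apply: Phi_inv_sqr_convex => //; lra.
pose E t := J (c + t) ^+ 2 + J (c - t) ^+ 2 + 4 * pi * t ^+ 2
  - 8 * pi ^+ 2 * v c ^+ 2 * t ^+ 2.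
have E0 : E 0 = 2 * J c ^+ 2 by rewrite /E addr0 subr0; ring.
suff : E 0 <= E x by rewrite E0 /E lerBrDr.
apply: (derive_ge0_le (df := E1) x0); last exact: E1_ge0.
move=> t /andP[t0 tx].
have hp : 0 < c + t < 1 by clear -x0 cx0 cx1 t0 tx; lra.
have hm : 0 < c - t < 1 by clear -x0 cx0 cx1 t0 tx; lra.
have h1 := is_derive_shift (f := fun y => J y ^+ 2) (c := c) (x := t)
  (is_derive_profile_sqr hp).
have h2 := is_derive_reflect (f := fun y => J y ^+ 2) (c := c) (x := t)
  (is_derive_profile_sqr hm).
by rewrite /E /E1; apply: is_derive_eq; rewrite /GRing.scale/=; ring.
Qed.

Let Phi_inv_abs c x : 0 <= x -> 0 < c - x -> c + x < 1 -> c <= 2^-1 ->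
  `|v (c + x)| <= - v (c - x).
Proof.
move=> x0 cx0 cx1 c2.
rewrite ler_norml opprK Phi_inv_le ?cx1 ?cx0 ?andbT //=; [|lra..].
rewrite -Phi_invN; last lra.
by rewrite Phi_inv_le; lra.
Qed.

(** To the left of 1 / 2 the point c + x is closer to 1 / 2 than c - x, hence the
    difference is nonnegative, and it is a concave function of x: it lies below its
    tangent at 0. *)
Let profile_sqr_odd c x : 0 <= x -> 0 < c - x -> c + x < 1 -> c <= 2^-1 ->
  0 <= J (c + x) ^+ 2 - J (c - x) ^+ 2 <= - (8 * pi * (v c * J c) * x).
Proof.
move=> x0 cx0 cx1 c2.
have vle t : 0 <= t <= x -> v (c + t) ^+ 2 <= v (c - t) ^+ 2.
  move=> /andP[t0 tx]; rewrite -(sqrrN (v (c - t))).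
  rewrite -(real_normK (num_real (v (c + t)))) lerXn2r ?nnegrE ?normr_ge0 //.
    by rewrite (le_trans (normr_ge0 (v (c + t)))) // Phi_inv_abs //; lra.
  by apply: Phi_inv_abs => //; lra.
apply/andP; split.
  rewrite subr_ge0 lerXn2r ?nnegrE ?(ltW (profile_gt0 _)) //.
  rewrite /J /phi ler_expR lerN2 ler_wpM2l ?pi_ge0 //.
  by apply: vle; lra.
pose D1 t := - (8 * pi * (v c * J c)) + 4 * pi * (v (c + t) * J (c + t)) +
  4 * pi * (v (c - t) * J (c - t)).
have D10 : D1 0 = 0 by rewrite /D1 addr0 subr0; ring.
have D1_ge0 t : 0 <= t <= x -> 0 <= D1 t.
  move=> /andP[t0 tx].
  have := @derive_ge0_le R D1
    (fun t => 8 * pi ^+ 2 * (v (c - t) ^+ 2 - v (c + t) ^+ 2)) 0 t t0.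
  rewrite D10; apply => u /andP[u0 ut].
    have hp : 0 < c + u < 1 by clear -x0 cx0 cx1 t0 tx u0 ut; lra.
    have hm : 0 < c - u < 1 by clear -x0 cx0 cx1 t0 tx u0 ut; lra.
    have h1 := is_derive_shift (f := fun y => v y * J y) (c := c) (x := u)
      (is_derive_Phi_inv_profile hp).
    have h2 := is_derive_reflect (f := fun y => v y * J y) (c := c) (x := u)
      (is_derive_Phi_inv_profile hm).
    rewrite /D1; apply: is_derive_eq; rewrite /GRing.scale/=; ring.
  apply: mulr_ge0; first by rewrite mulr_ge0 ?sqr_ge0.
  by rewrite subr_ge0 vle //; lra.
pose D t := - (8 * pi * (v c * J c) * t) - (J (c + t) ^+ 2 - J (c - t) ^+ 2).
have D0 : D 0 = 0 by rewrite /D addr0 subr0; ring.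
suff : D 0 <= D x by rewrite D0 /D subr_ge0.
apply: (derive_ge0_le (df := D1) x0); last exact: D1_ge0.
move=> t /andP[t0 tx].
have hp : 0 < c + t < 1 by clear -x0 cx0 cx1 t0 tx; lra.
have hm : 0 < c - t < 1 by clear -x0 cx0 cx1 t0 tx; lra.
have h1 := is_derive_shift (f := fun y => J y ^+ 2) (c := c) (x := t)
  (is_derive_profile_sqr hp).
have h2 := is_derive_reflect (f := fun y => J y ^+ 2) (c := c) (x := t)
  (is_derive_profile_sqr hm).
by rewrite /D /D1; apply: is_derive_eq; rewrite /GRing.scale/=; ring.
Qed.

(** With S = s + t and T = s - t the hypothesis reads
    (S^2 - 4 j^2) (T^2 - 4 j^2) <= 0, while T^2 <= S^2. *)
Let two_point_algebra (j s t : R) : 0 <= j -> 0 <= s -> 0 <= t ->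
  (s ^+ 2 - t ^+ 2) ^+ 2 <= 8 * j ^+ 2 * (s ^+ 2 + t ^+ 2 - 2 * j ^+ 2) ->
  2 * j <= s + t.
Proof.
move=> j0 s0 t0 h; rewrite leNgt; apply/negP => st.
have h1 : ((s + t) ^+ 2 - 4 * j ^+ 2) * ((s - t) ^+ 2 - 4 * j ^+ 2) <= 0.
  rewrite (_ : _ * _ = (s ^+ 2 - t ^+ 2) ^+ 2 -
    8 * j ^+ 2 * (s ^+ 2 + t ^+ 2 - 2 * j ^+ 2)); last by ring.
  by rewrite subr_le0.
have a : (s + t) ^+ 2 < 4 * j ^+ 2.
  rewrite (_ : 4 * j ^+ 2 = (2 * j) ^+ 2); last by ring.
  by rewrite ltrXn2r ?nnegrE //; lra.
have b : (s - t) ^+ 2 <= (s + t) ^+ 2.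
  by rewrite -subr_ge0 (_ : _ - _ = 4 * (s * t)) ?mulr_ge0 //; ring.
have : 0 < ((s + t) ^+ 2 - 4 * j ^+ 2) * ((s - t) ^+ 2 - 4 * j ^+ 2).
  by rewrite nmulr_rgt0 subr_lt0 // (le_lt_trans b).
by rewrite ltNge h1.
Qed.

Let two_point_centered c x : 0 <= x -> 0 < c - x -> c + x < 1 -> c <= 2^-1 ->
  2 * J c <= Num.sqrt (J (c + x) ^+ 2 + 2 * pi * x ^+ 2) +
             Num.sqrt (J (c - x) ^+ 2 + 2 * pi * x ^+ 2).
Proof.
move=> x0 cx0 cx1 c2.
have nn a : 0 <= J a ^+ 2 + 2 * pi * x ^+ 2.
  by rewrite addr_ge0 ?sqr_ge0 // !mulr_ge0 ?pi_ge0 ?sqr_ge0.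
apply: two_point_algebra; rewrite ?sqrtr_ge0 ?(ltW (profile_gt0 _)) //.
rewrite !sqr_sqrtr //.
have ev := profile_sqr_even x0 cx0 cx1.
have /andP[od0 od1] := profile_sqr_odd x0 cx0 cx1 c2.
set A := J (c + x) ^+ 2 in ev od0 od1 *; set B := J (c - x) ^+ 2 in ev od0 od1 *.
rewrite (_ : _ - _ = A - B); last by ring.
apply: (@le_trans _ _ ((8 * pi * (v c * J c) * x) ^+ 2)).
  by rewrite -[leRHS]sqrrN lerXn2r ?nnegrE // (le_trans od0).
rewrite (_ : _ ^+ 2 = 8 * J c ^+ 2 * (8 * pi ^+ 2 * v c ^+ 2 * x ^+ 2)); last by ring.
apply: ler_wpM2l; first by rewrite mulr_ge0 ?sqr_ge0.
rewrite lerBrDl (le_trans ev) // le_eqVlt; apply/orP; left; apply/eqP; ring.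
Qed.

(** Put a = c + x and b = c - x. By squaring twice, the claim follows from
    D^2 <= 8 J(c)^2 S with D = J(a)^2 - J(b)^2 and
    S = J(a)^2 + J(b)^2 + 4 pi x^2 - 2 J(c)^2; the lower bound on S and the upper bound
    on D meet exactly. *)
Lemma bobkov_two_point a b : 0 < a < 1 -> 0 < b < 1 ->
  J ((a + b) / 2) <= (Num.sqrt (J a ^+ 2 + pi / 2 * (a - b) ^+ 2) +
                      Num.sqrt (J b ^+ 2 + pi / 2 * (a - b) ^+ 2)) / 2.
Proof.
wlog ab : a b / b <= a => [hw ha hb|].
  case: (leP b a) => [ba|/ltW ba]; first exact: hw.
  have := hw b a ba hb ha; rewrite [b + a]addrC -(sqrrN (b - a)) opprB.
  by rewrite [X in _ <= X / 2]addrC.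
wlog c2 : a b ab / (a + b) / 2 <= 2^-1 => [hw ha hb|ha hb].
  case: (leP ((a + b) / 2) 2^-1) => [h|h]; first exact: hw.
  have p1 : 1 - a <= 1 - b by lra.
  have p2 : (1 - b + (1 - a)) / 2 <= 2^-1 by lra.
  have p3 : 0 < 1 - b < 1 by lra.
  have p4 : 0 < 1 - a < 1 by lra.
  have := hw _ _ p1 p2 p3 p4.
  rewrite (_ : 1 - b - (1 - a) = a - b); last by ring.
  rewrite (_ : (1 - b + (1 - a)) / 2 = 1 - (a + b) / 2); last by field.
  rewrite !profile_sym //; last lra.
  by rewrite [X in _ <= X / 2]addrC.
rewrite ler_pdivlMr // mulrC.
have ea : (a + b) / 2 + (a - b) / 2 = a by field.
have eb : (a + b) / 2 - (a - b) / 2 = b by field.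
have := @two_point_centered ((a + b) / 2) ((a - b) / 2).
rewrite ea eb (_ : 2 * pi * ((a - b) / 2) ^+ 2 = pi / 2 * (a - b) ^+ 2).
  by apply => //; lra.
by move: (pi : R) => p; field.
Qed.

End two_point.

(** * Central binomial coefficients *)

Section segment_integral.
Context {R : realType}.
Implicit Types (f F : R -> R) (a b : R).

Lemma continuous_integrable_segment f a b : continuous f ->
  (@lebesgue_measure R).-integrable `[a, b] (EFin \o f).
Proof.
move=> cf; apply: continuous_compact_integrable; first exact: segment_compact.
exact: continuous_subspaceT.
Qed.

Lemma Rintegral_FTC F f a b : a < b -> continuous f ->
  (forall x : R, is_derive x 1 F (f x)) ->
  \int[lebesgue_measure]_(x in `[a, b]) f x = F b - F a.
Proof.
move=> ab cf dF; have cF x := is_derive_continuous (dF x).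
rewrite /Rintegral (@continuous_FTC2 R f F a b ab).
- by [].
- exact: continuous_subspaceT.
- split => [x _||]; first by case: (dF x).
  + exact: cvg_at_right_filter (cF a).
  + exact: cvg_at_left_filter (cF b).
- by move=> x _; rewrite derive1E; case: (dF x).
Qed.

End segment_integral.

Section wallis.
Context {R : realType}.

Let W n : R := \int[lebesgue_measure]_(x in `[0, pi / 2]) (sin x ^+ n).

Let pi2_gt0 : 0 < pi / 2 :> R. Proof. by rewrite divr_gt0 ?pi_gt0. Qed.

Let continuous_sinX n : continuous (fun x : R => sin x ^+ n).
Proof.
move=> x; apply: (@continuous_comp _ _ _ sin (fun y : R => y ^+ n)).
  exact: continuous_sin.
exact: exprn_continuous.
Qed.


Let W0 : W 0 = pi / 2.
Proof.
have d (x : R) : is_derive x 1 id (sin x ^+ 0) by rewrite expr0; exact: is_derive_id.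
by rewrite /W (Rintegral_FTC pi2_gt0 (@continuous_sinX 0) d) subr0.
Qed.

Let W1 : W 1 = 1.
Proof.
have d (x : R) : is_derive x 1 (fun x => - cos x) (sin x ^+ 1).
  by apply: is_derive_eq; rewrite expr1 opprK.
rewrite /W (Rintegral_FTC pi2_gt0 (@continuous_sinX 1) d).
by rewrite cos_pihalf cos0 oppr0 sub0r opprK.
Qed.

Let continuous_csinX (c : R) n : continuous (fun x : R => c * sin x ^+ n).
Proof. by move=> x; apply: cvgM; [exact: cvg_cst|exact: continuous_sinX]. Qed.

Let si k := @continuous_integrable_segment R _ 0 (pi / 2) (@continuous_sinX k).

Let W_rec n : n.+2%:R * W n.+2 = n.+1%:R * W n.
Proof.
apply/eqP; rewrite eq_sym -subr_eq0 /W -!RintegralZl //; [|exact: si..].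
have ci c k := @continuous_integrable_segment R _ 0 (pi / 2) (@continuous_csinX c k).
rewrite -RintegralB //.
have c : continuous (fun x : R => n.+1%:R * sin x ^+ n - n.+2%:R * sin x ^+ n.+2).
  by move=> x; apply: cvgB; exact: continuous_csinX.
have d (x : R) : is_derive x 1 (fun x => cos x * sin x ^+ n.+1)
    (n.+1%:R * sin x ^+ n - n.+2%:R * sin x ^+ n.+2).
  have h : is_derive x 1 (fun x : R => sin x ^+ n.+1) (n.+1%:R * sin x ^+ n * cos x).
    have := @is_deriveX _ _ sin n.+1 x 1 _ (is_derive_sin x).
    by rewrite exprfctE.
  apply: is_derive_eq; rewrite /GRing.scale/=.
  have -> : n.+2%:R = n.+1%:R + 1 :> R by rewrite -natr1.
  have c2 := cos2Dsin2 x.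
  rewrite !exprS; set s := sin x ^+ n.
  have -> : cos x * (n.+1%:R * s * cos x) = n.+1%:R * s * (1 - sin x ^+ 2).
    by rewrite -c2; ring.
  by ring.
by rewrite (Rintegral_FTC pi2_gt0 c d) cos_pihalf sin0 mul0r exprS mul0r mulr0 subrr.
Qed.

Let sin_ge0 (x : R) : 0 <= x <= pi / 2 -> 0 <= sin x.
Proof.
move=> /andP[x0 x1]; rewrite sin_ge0_pi // x0 /=.
by apply: (le_trans x1); rewrite ler_pdivrMr // ler_peMr ?pi_ge0 // ler1n.
Qed.

Let W_ge0 n : 0 <= W n.
Proof.
by apply: Rintegral_ge0 => x; rewrite /= in_itv /= => /sin_ge0 x0; rewrite exprn_ge0.
Qed.

Let W_decr n : W n.+1 <= W n.
Proof.
apply: le_Rintegral; [by []|exact: si|exact: si|move=> x].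
rewrite /= in_itv /= => /sin_ge0 x0.
by rewrite exprS ler_piMl ?sin_le1 // exprn_ge0.
Qed.

Let W_mul n : n.+1%:R * (W n * W n.+1) = pi / 2.
Proof.
elim: n => [|n IH]; first by rewrite W0 W1 mul1r mulr1.
by rewrite -IH mulrCA mulrC mulrCA W_rec; ring.
Qed.

Let central_bin_rec m :
  (m.+1 * 'C(m.+1.*2, m.+1) = 2 * (m.*2.+1 * 'C(m.*2, m)))%N.
Proof.
rewrite doubleS -mul_bin_diag /= -[in LHS]doubleS -mul2n -mulnA; congr muln.
rewrite -[m.*2 in RHS]/(m.*2.+1.-1) mul_bin_down; congr (_ * _)%N.
by rewrite -addnn -addSn addnK.
Qed.

Let W_even m : W m.*2 = pi / 2 * ('C(m.*2, m)%:R / 4 ^+ m).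
Proof.
elim: m => [|m IH]; first by rewrite W0 bin0 expr0 divr1 mulr1.
have h := W_rec m.*2.
have c : m.+1%:R * 'C(m.+1.*2, m.+1)%:R = 2 * (m.*2.+1%:R * 'C(m.*2, m)%:R) :> R.
  by rewrite -!natrM central_bin_rec.
rewrite IH in h.
have m0 : m.+1%:R != 0 :> R by rewrite pnatr_eq0.
have e : m.*2.+2%:R = 2 * m.+1%:R :> R by rewrite -natrM mul2n.
have -> : 'C(m.+1.*2, m.+1)%:R = 2 * (m.*2.+1%:R * 'C(m.*2, m)%:R) / m.+1%:R :> R.
  by rewrite -c mulrC mulKf.
have -> : W m.+1.*2 = m.*2.+1%:R * (pi / 2 * ('C(m.*2, m)%:R / 4 ^+ m)) / m.*2.+2%:R.
  by rewrite -h mulrC mulKf // pnatr_eq0.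
rewrite e exprS.
have p4 : 4 ^+ m != 0 :> R by rewrite expf_neq0 // pnatr_eq0.
move: (pi : R) (4 ^+ m : R) p4 (m.+1%:R : R) m0 => p q q0 M M0.
by field; rewrite q0 M0.
Qed.

(** The integrals W n of sin^n over a quarter period decrease with n and satisfy
    (n + 1) W n W (n + 1) = pi / 2, and W (2 m) is pi / 2 times the central binomial
    probability. *)
Lemma central_bin_le m : (0 < m)%N ->
  ('C(m.*2, m)%:R / 4 ^+ m) ^+ 2 <= (pi * m%:R)^-1 :> R.
Proof.
case: m => // m _.
have pi0 := pi_gt0 R.
have e : 'C(m.+1.*2, m.+1)%:R / 4 ^+ m.+1 = 2 / pi * W m.+1.*2.
  rewrite W_even; have := lt0r_neq0 pi0; move: (pi : R) (_ / _) => p q p0.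
  by field.
have l : W m.+1.*2 ^+ 2 <= pi / 2 / (m.+1.*2)%:R.
  rewrite ler_pdivlMr ?ltr0n // doubleS -(W_mul m.*2.+1) mulrC ler_pM2l ?ltr0n //.
  by rewrite expr2 ler_wpM2r.
rewrite e exprMn.
apply: (@le_trans _ _ ((2 / pi) ^+ 2 * (pi / 2 / (m.+1.*2)%:R))).
  by rewrite ler_wpM2l ?sqr_ge0.
have m0 : m.+1%:R != 0 :> R by rewrite pnatr_eq0.
rewrite -[_.*2]mul2n natrM le_eqVlt; apply/orP; left; apply/eqP.
move: m0 (lt0r_neq0 pi0); move: (pi : R) (m.+1%:R : R) => p M M0 p0.
by field; rewrite p0 M0.
Qed.

End wallis.

(** * Tensorization over coin tosses *)

Section mean.
Context {R : realType} {T : Type}.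
Implicit Types (E : (T -> R) -> R) (f g : T -> R).

(** Strict positivity is what keeps the mean of a function with values in ]0, 1[
    inside ]0, 1[, where Phi_inv is defined. *)
Definition mean E : Prop :=
  [/\ E (fun=> 1) = 1,
      forall a b f g, E (fun x => a * f x + b * g x) = a * E f + b * E g,
      forall f, (forall x, 0 <= f x) -> 0 <= E f &
      forall f, (forall x, 0 < f x) -> 0 < E f].

Variable E : (T -> R) -> R.
Hypothesis hE : mean E.

Lemma mean_scale a f : E (fun x => a * f x) = a * E f.
Proof.
case: hE => _ lin _ _; have := lin a 0 f f; rewrite mul0r addr0 => <-.
by congr E; apply/funext => x; rewrite mul0r addr0.
Qed.

Lemma mean_cst a : E (fun=> a) = a.
Proof.
case: hE => one _ _ _; rewrite -[RHS]mulr1 -one -mean_scale.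
by congr E; apply/funext => x; rewrite mulr1.
Qed.

Lemma meanD f g : E (fun x => f x + g x) = E f + E g.
Proof.
case: hE => _ lin _ _; have := lin 1 1 f g; rewrite !mul1r => <-.
by congr E; apply/funext => x; rewrite !mul1r.
Qed.

Lemma meanB f g : E (fun x => f x - g x) = E f - E g.
Proof.
case: hE => _ lin _ _; have := lin 1 (-1) f g; rewrite mul1r mulN1r => <-.
by congr E; apply/funext => x; rewrite mul1r mulN1r.
Qed.

Lemma mean_le f g : (forall x, f x <= g x) -> E f <= E g.
Proof.
case: (hE) => _ _ nn _ fg; rewrite -subr_ge0 -meanB; apply: nn => x.
by rewrite subr_ge0.
Qed.

Lemma mean01 f : (forall x, 0 < f x < 1) -> 0 < E f < 1.
Proof.
case: (hE) => one _ _ pos f01; rewrite pos; last by move=> x; case/andP: (f01 x).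
rewrite -subr_gt0 -{1}one -meanB; apply: pos => x.
by rewrite subr_gt0; case/andP: (f01 x).
Qed.

(** Minkowski's inequality: the Euclidean norm is the supremum of the linear forms
    with unit coefficients. *)
Lemma mean_minkowski f g :
  Num.sqrt (E f ^+ 2 + E g ^+ 2) <= E (fun x => Num.sqrt (f x ^+ 2 + g x ^+ 2)).
Proof.
set r := Num.sqrt _.
have r2 : r ^+ 2 = E f ^+ 2 + E g ^+ 2 by rewrite sqr_sqrtr // addr_ge0 ?sqr_ge0.
have [r0|r0] := leP r 0.
  by apply: le_trans r0 _; case: hE => _ _ + _; apply => x; exact: sqrtr_ge0.
have -> : r = E (fun x => E f / r * f x + E g / r * g x).
  case: hE => _ -> _ _; rewrite mulrAC [_ / r * _]mulrAC -mulrDl -!expr2 -r2.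
  by rewrite expr2 mulfK ?gt_eqF.
apply: mean_le => x.
apply: le_trans (ler_norm _) _.
rewrite -sqrtr_sqr ler_wsqrtr //.
have -> : f x ^+ 2 + g x ^+ 2 =
    (E f / r * f x + E g / r * g x) ^+ 2 + (E f / r * g x - E g / r * f x) ^+ 2.
  have u : (E f / r) ^+ 2 + (E g / r) ^+ 2 = 1.
    by rewrite !expr_div_n -mulrDl -r2 mulfV // expf_neq0 // gt_eqF.
  rewrite -[LHS]mul1r -u; ring.
by rewrite lerDl sqr_ge0.
Qed.

End mean.

Section binomial_chain.
Context {R : realType}.
Implicit Types (N n k : nat) (f g : seq nat -> R) (E : (seq nat -> R) -> R).
Implicit Types G : (seq nat -> R) -> seq nat -> R.

Definition bin_weight N k : R := 'C(N, k)%:R / 2 ^+ N.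

Definition binE N (h : nat -> R) : R := \sum_(k < N.+1) bin_weight N k * h k.

Lemma binE0 h : binE 0 h = h 0%N.
Proof. by rewrite /binE big_ord1 /bin_weight bin0 expr0 divr1 mul1r. Qed.

Lemma binE_rec N h :
  binE N.+1 h = (binE N h + binE N (fun k => h k.+1)) / 2.
Proof.
have -> : binE N h = \sum_(k < N.+2) bin_weight N k * h k.
  by rewrite big_ord_recr /= /bin_weight bin_small // !mul0r addr0.
rewrite /binE [in LHS]big_ord_recl [in RHS]big_ord_recl /= -addrA -big_split /=.
rewrite mulrDl mulr_suml; congr (_ + _).
  by rewrite /bin_weight !bin0 exprS invfM; ring.
apply: eq_bigr => i _; rewrite /bump /= !add1n /bin_weight binS natrD exprS invfM; ring.
Qed.

(** One more coordinate, distributed as the number of successes in N tosses of a fair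
    coin *)
Definition bin_prod N E f := binE N (fun k => E (fun s => f (k :: s))).

Lemma bin_prod_rec N E f : bin_prod N.+1 E f =
  (bin_prod N E f + bin_prod N E (fun s => f ((head 0 s).+1 :: behead s))) / 2.
Proof. exact: binE_rec. Qed.

Lemma bin_prod_mean N E : mean E -> mean (bin_prod N E).
Proof.
move=> hE; elim: N => [|N [one lin nn pos]].
  rewrite /bin_prod; split => *; rewrite !binE0.
  - exact: mean_cst.
  - by case: hE => _ lin _ _; rewrite lin.
  - by case: hE => _ _ nn _; apply: nn.
  - by case: hE => _ _ _ pos; apply: pos.
split => *; rewrite !bin_prod_rec.
- by rewrite one; field.
- by rewrite !lin; field.
- by rewrite divr_ge0 // addr_ge0 // nn.
- by rewrite divr_gt0 // addr_gt0 // pos.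
Qed.

(** The coin tosses seen by the counts: in state k, one of k heads or one of N - k
    tails is turned over, and each of the moves carries the weight pi / 2 of the
    two-point inequality. At k = 0 the factor k annihilates the term in which the
    predecessor of 0 would appear. *)
Definition bin_energy N G f s : R :=
  pi / 2 * ((head 0%N s)%:R * (f s - f ((head 0 s).-1 :: behead s)%N) ^+ 2 +
            (N - head 0 s)%N%:R * (f ((head 0 s).+1 :: behead s)%N - f s) ^+ 2) +
  G (fun t => f (head 0%N s :: t)) (behead s).

Definition bobkov E G : Prop :=
  forall f, (forall s, 0 < f s < 1) ->
    profile (E f) <= E (fun s => Num.sqrt (profile (f s) ^+ 2 + G f s)).

Lemma bin_prod_ext N E f g :
  (forall k s, (k <= N)%N -> f (k :: s) = g (k :: s)) ->
  bin_prod N E f = bin_prod N E g.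
Proof.
move=> fg; apply: eq_bigr => k _; congr (_ * E _); apply/funext => s.
by apply: fg; rewrite -ltnS.
Qed.

(** Induction on N. The new toss is an independent coordinate: the two-point inequality
    is applied to the two conditional means, and Minkowski's inequality absorbs the
    energy of the other tosses. In terms of the total count k, the k - 1 or k earlier
    heads and the new toss together provide exactly the k and N + 1 - k moves of the
    next energy. *)
Lemma bin_prod_bobkov N E G : mean E -> (forall f s, 0 <= G f s) ->
  bobkov E G -> bobkov (bin_prod N E) (bin_energy N G).
Proof.
move=> hE G0 bE; elim: N => [|N IH] f f01.
  rewrite /bin_prod !binE0; apply: le_trans (bE _ _) _ => //.
  apply: mean_le => // s; rewrite ler_wsqrtr // lerD2l /bin_energy /=.
  by rewrite sub0n !mul0r addr0 mulr0 add0r.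
have hN := bin_prod_mean N hE.
pose f1 s := f ((head 0 s).+1 :: behead s)%N.
have f101 s : 0 < f1 s < 1 by exact: f01.
pose a := bin_prod N E f; pose b := bin_prod N E f1.
have a01 : 0 < a < 1 by exact: mean01.
have b01 : 0 < b < 1 by exact: mean01.
have GN0 g s : 0 <= bin_energy N G g s.
  rewrite addr_ge0 // mulr_ge0 ?divr_ge0 ?pi_ge0 // addr_ge0 //.
    by rewrite mulr_ge0 ?sqr_ge0.
  by rewrite mulr_ge0 ?sqr_ge0.
have step g : (forall s, 0 < g s < 1) ->
    Num.sqrt (profile (bin_prod N E g) ^+ 2 + pi / 2 * (a - b) ^+ 2) <=
    bin_prod N E (fun s => Num.sqrt
      (profile (g s) ^+ 2 + (bin_energy N G g s + pi / 2 * (f1 s - f s) ^+ 2))).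
  move=> g01; pose c : R := Num.sqrt (pi / 2).
  have c2 : c ^+ 2 = pi / 2 by rewrite sqr_sqrtr // divr_ge0 ?pi_ge0.
  pose h s : R := Num.sqrt (profile (g s) ^+ 2 + bin_energy N G g s).
  have -> : (fun s => Num.sqrt (profile (g s) ^+ 2 +
      (bin_energy N G g s + pi / 2 * (f1 s - f s) ^+ 2))) =
      (fun s => Num.sqrt (h s ^+ 2 + (c * (f1 s - f s)) ^+ 2)).
    apply/funext => s; congr Num.sqrt.
    have -> : h s ^+ 2 = profile (g s) ^+ 2 + bin_energy N G g s.
      by rewrite sqr_sqrtr // addr_ge0 ?sqr_ge0 ?GN0.
    by rewrite exprMn c2 addrA.
  apply: le_trans (mean_minkowski hN _ _); rewrite ler_wsqrtr // lerD //.
    rewrite lerXn2r ?nnegrE ?(ltW (profile_gt0 _)) //; last exact: IH.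
    by case: hN => _ _ + _; apply => s; exact: sqrtr_ge0.
  rewrite mean_scale // meanB // exprMn c2 -/a -/b.
  by rewrite -(sqrrN (a - b)) opprB.
rewrite bin_prod_rec -/a -/b; apply: le_trans (bobkov_two_point a01 b01) _.
rewrite bin_prod_rec ler_pM2r ?invr_gt0 // lerD //.
  apply: le_trans (step _ f01) _; rewrite le_eqVlt; apply/orP; left; apply/eqP.
  apply: bin_prod_ext => k s kN; congr Num.sqrt; congr (_ + _).
  by rewrite /bin_energy /f1 /= subSn // -natr1; ring.
apply: le_trans (step _ f101) _; rewrite le_eqVlt; apply/orP; left; apply/eqP.
apply: bin_prod_ext => -[|k] s kN; congr Num.sqrt; congr (_ + _).
  by rewrite /bin_energy /f1 /= subn0 subSS subn0; ring.
by rewrite /bin_energy /f1 /= !subSS -(natr1 k.+1); ring.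
Qed.

Fixpoint binomial_mean N n : (seq nat -> R) -> R :=
  if n is m.+1 then bin_prod N (binomial_mean N m) else fun f => f [::].

Fixpoint binomial_energy N n : (seq nat -> R) -> seq nat -> R :=
  if n is m.+1 then bin_energy N (binomial_energy N m) else fun _ _ => 0.

Lemma binomial_meanP N n : mean (binomial_mean N n).
Proof.
elim: n => [|n IH] /=; last exact: bin_prod_mean.
by split => //= f; apply.
Qed.

Lemma binomial_energy_ge0 N n f s : 0 <= binomial_energy N n f s.
Proof.
elim: n f s => [|n IH] f s //=.
rewrite addr_ge0 // mulr_ge0 ?divr_ge0 ?pi_ge0 // addr_ge0 //.
  by rewrite mulr_ge0 ?sqr_ge0.
by rewrite mulr_ge0 ?sqr_ge0.
Qed.

Lemma binomial_bobkov N n :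
  bobkov (binomial_mean N n) (binomial_energy N n).
Proof.
elim: n => [|n IH] /=.
  by move=> f f01 /=; rewrite addr0 sqrtr_sqr ger0_norm // ltW ?profile_gt0.
apply: bin_prod_bobkov => //; first exact: binomial_meanP.
exact: binomial_energy_ge0.
Qed.

(** In each coordinate N moves are possible. *)
Lemma binomial_energy_le N n f s (a : nat -> R) :
  size s = n -> all (fun k => k <= N)%N s ->
  (forall i, (i < n)%N ->
    (f s - f (set_nth 0%N s i (nth 0 s i).-1)) ^+ 2 <= a i /\
    (f (set_nth 0%N s i (nth 0 s i).+1) - f s) ^+ 2 <= a i) ->
  binomial_energy N n f s <= pi / 2 * N%:R * \sum_(i < n) a i.
Proof.
elim: n f s a => [|n IH] f s a; first by rewrite big_ord0 mulr0.
case: s => // k s [sz] /= /andP[kN sN] h.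
rewrite big_ord_recl mulrDr /bin_energy /= lerD //.
  rewrite -[leRHS]mulrA ler_wpM2l ?divr_ge0 ?pi_ge0 //.
  have [h1 h2] := h 0%N isT.
  rewrite -{2}(subnKC kN) natrD mulrDl lerD // ler_wpM2l //.
by apply: (IH _ _ (fun i => a i.+1)) => // i ii; exact: h i.+1 ii.
Qed.

End binomial_chain.

(** * A smooth approximation of the distance to finitely many points *)

Section weighted_average.
Context {R : realType} {I : finType}.
Variable w : I -> R.
Hypotheses (w0 : forall p, 0 <= w p) (w1 : \sum_p w p = 1).

Lemma average_sqr_le (a : I -> R) :
  (\sum_p w p * a p) ^+ 2 <= \sum_p w p * a p ^+ 2.
Proof.
set m := \sum_p w p * a p.
have : 0 <= \sum_p w p * (a p - m) ^+ 2.
  by apply: sumr_ge0 => p _; rewrite mulr_ge0 ?sqr_ge0.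
have -> : \sum_p w p * (a p - m) ^+ 2 = \sum_p w p * a p ^+ 2 - m ^+ 2.
  have -> : \sum_p w p * (a p - m) ^+ 2 =
      \sum_p (w p * a p ^+ 2 - (2 * m * (w p * a p) - m ^+ 2 * w p)).
    by apply: eq_bigr => p _; ring.
  rewrite sumrB sumrB -!mulr_sumr w1 -/m; ring.
by rewrite subr_ge0.
Qed.

(** Jensen's inequality, from the tangent of exp at the average *)
Lemma average_exp_ge (a : I -> R) :
  expR (\sum_p w p * a p) <= \sum_p w p * expR (a p).
Proof.
set m := \sum_p w p * a p.
apply: (@le_trans _ _ (\sum_p expR m * (w p * (1 + (a p - m))))).
  rewrite -mulr_sumr ler_peMr ?expR_ge0 // le_eqVlt; apply/orP; left; apply/eqP.
  have -> : \sum_p w p * (1 + (a p - m)) = \sum_p (w p * a p + (1 - m) * w p).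
    by apply: eq_bigr => p _; ring.
  by rewrite big_split /= -mulr_sumr w1 -/m; ring.
apply: ler_sum => p _; rewrite mulrCA ler_wpM2l //.
by rewrite -[in leRHS](subrKC m (a p)) expRD ler_wpM2l ?expR_ge0 ?expR_ge1Dx.
Qed.

Let expR_le_quadratic (z : R) : `|z| <= 2^-1 -> expR z <= 1 + (z + 2 * z ^+ 2).
Proof.
move=> /ler_normlP[z1 z2].
have h : 1 - z <= expR (- z) by rewrite -[1 - z]/(1 + - z) expR_ge1Dx.
have h1 : 0 < 1 - z by lra.
rewrite -[z in leLHS]opprK expRN -div1r ler_pdivrMr ?expR_gt0 //.
apply: (@le_trans _ _ ((1 + (z + 2 * z ^+ 2)) * (1 - z))).
  have := sqr_ge0 z; nra.
by rewrite ler_wpM2l //; have := sqr_ge0 z; lra.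
Qed.

Lemma average_exp_le (a : I -> R) : (forall p, `|a p| <= 2^-1) ->
  \sum_p w p * expR (a p) <= expR (\sum_p w p * a p + 2 * \sum_p w p * a p ^+ 2).
Proof.
move=> a2; apply: le_trans (expR_ge1Dx _).
have -> : 1 + (\sum_p w p * a p + 2 * \sum_p w p * a p ^+ 2) =
    \sum_p w p * (1 + (a p + 2 * a p ^+ 2)).
  rewrite mulr_sumr -[X in X + _]w1 -!big_split /=.
  by apply: eq_bigr => p _; ring.
by apply: ler_sum => p _; rewrite ler_wpM2l // expR_le_quadratic.
Qed.

End weighted_average.

Definition shift_coord {R : realType} (x : nat -> R) (i : nat) (v : R) : nat -> R :=
  fun j => if j == i then x i + v else x j.

Section soft_distance.
Context {R : realType} {I : finType}.
Variables (n : nat) (p : I -> nat -> R) (delta beta : R).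
Hypotheses (delta0 : 0 < delta) (beta0 : 0 < beta) (I0 : (0 < #|I|)%N).
Implicit Types (x : nat -> R) (q : I).

Definition soft_norm x q : R :=
  Num.sqrt (delta ^+ 2 + \sum_(i < n) (x i - p q i) ^+ 2).

Let Z x : R := \sum_q expR (- (beta * soft_norm x q)).

(** A soft minimum of the soft norms: it lies between their minimum minus
    ln #|I| / beta and their minimum. *)
Definition soft_dist x : R := - ln (Z x) / beta.

Let le_of_sqr (a b : R) : 0 <= b -> a ^+ 2 <= b ^+ 2 -> a <= b.
Proof.
move=> b0 h; apply: le_trans (ler_norm a) _.
by rewrite -[leRHS]ger0_norm // -!sqrtr_sqr ler_wsqrtr.
Qed.

Let soft_norm_sqr x q :
  soft_norm x q ^+ 2 = delta ^+ 2 + \sum_(i < n) (x i - p q i) ^+ 2.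
Proof. by rewrite sqr_sqrtr // addr_ge0 ?sqr_ge0 ?sumr_ge0 // => i _; rewrite sqr_ge0. Qed.

Let soft_norm_ge_delta x q : delta <= soft_norm x q.
Proof.
rewrite -(ger0_norm (ltW delta0)) -sqrtr_sqr ler_wsqrtr // lerDl sumr_ge0 // => i _.
exact: sqr_ge0.
Qed.

Let soft_norm_gt0 x q : 0 < soft_norm x q.
Proof. exact: lt_le_trans delta0 (soft_norm_ge_delta x q). Qed.

Let Z_gt0 x : 0 < Z x.
Proof.
have [q _] := card_gt0P I0.
rewrite /Z (bigD1 q) //= ltr_pwDl ?expR_gt0 // sumr_ge0 // => ? _; exact: expR_ge0.
Qed.

Lemma soft_dist_le x q : soft_dist x <= soft_norm x q.
Proof.
rewrite /soft_dist ler_pdivrMr // lerNl mulrC -(expRK (- _)) ler_ln ?posrE ?expR_gt0 //.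
by rewrite /Z (bigD1 q) //= lerDl sumr_ge0 // => ? _; exact: expR_ge0.
Qed.

Lemma soft_dist_ge x d : (forall q, d <= soft_norm x q) ->
  d - ln #|I|%:R / beta <= soft_dist x.
Proof.
move=> h; rewrite /soft_dist ler_pdivlMr // mulrBl divfK ?gt_eqF // lerBlDr.
rewrite -lerBlDl opprK -lerBrDl.
have -> : ln #|I|%:R - d * beta = ln (#|I|%:R * expR (- (beta * d))) :> R.
  by rewrite lnM ?posrE ?ltr0n ?expR_gt0 // expRK mulrC.
rewrite ler_ln ?posrE ?mulr_gt0 ?ltr0n ?expR_gt0 // mulr_natl -sumr_const.
by apply: ler_sum => q _; rewrite ler_expR lerN2 ler_pM2l.
Qed.

Let w x q := expR (- (beta * soft_norm x q)) / Z x.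

Let w_ge0 x q : 0 <= w x q. Proof. by rewrite divr_ge0 ?expR_ge0 ?ltW. Qed.

Let w_sum x : \sum_q w x q = 1.
Proof. by rewrite /w -mulr_suml -/(Z x) mulfV ?gt_eqF ?Z_gt0. Qed.

Definition soft_grad x i : R := \sum_q w x q * ((x i - p q i) / soft_norm x q).

(** The gradient is a convex combination of vectors of norm at most 1. *)
Lemma soft_grad_sqr_sum x : \sum_(i < n) soft_grad x i ^+ 2 <= 1.
Proof.
apply: (@le_trans _ _
  (\sum_(i < n) \sum_q w x q * ((x i - p q i) / soft_norm x q) ^+ 2)).
  by apply: ler_sum => i _; exact: average_sqr_le (w_ge0 x) (w_sum x) _.
rewrite exchange_big /= -(w_sum x); apply: ler_sum => q _.
rewrite -mulr_sumr ler_piMr //.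
have -> : \sum_(i < n) ((x i - p q i) / soft_norm x q) ^+ 2 =
    (\sum_(i < n) (x i - p q i) ^+ 2) / soft_norm x q ^+ 2.
  by rewrite mulr_suml; apply: eq_bigr => i _; rewrite expr_div_n.
by rewrite ler_pdivrMr ?exprn_gt0 // mul1r soft_norm_sqr lerDr sqr_ge0.
Qed.

Let soft_norm_shift x i v q : (i < n)%N ->
  soft_norm (shift_coord x i v) q ^+ 2 =
  soft_norm x q ^+ 2 + 2 * v * (x i - p q i) + v ^+ 2.
Proof.
move=> ii; rewrite !soft_norm_sqr (bigD1 (Ordinal ii)) //=.
rewrite [in RHS](bigD1 (Ordinal ii)) //= /shift_coord eqxx.
rewrite (eq_bigr (fun j : 'I_n => (x j - p q j) ^+ 2)); first by ring.
by move=> j /negbTE; rewrite -(inj_eq val_inj) /= => ->.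
Qed.

Let coord_le x i q : (i < n)%N -> (x i - p q i) ^+ 2 <= soft_norm x q ^+ 2.
Proof.
move=> ii; rewrite soft_norm_sqr (bigD1 (Ordinal ii)) //= addrCA lerDl.
by rewrite addr_ge0 ?sqr_ge0 // sumr_ge0 // => j _; exact: sqr_ge0.
Qed.

Let soft_norm_shift_ge x i v q : (i < n)%N ->
  v * ((x i - p q i) / soft_norm x q) <= soft_norm (shift_coord x i v) q - soft_norm x q.
Proof.
move=> ii; have e := soft_norm_shift x v q ii; have a2 := coord_le x q ii.
have r0 := soft_norm_gt0 x q; have r'0 := soft_norm_gt0 (shift_coord x i v) q.
move: e a2 r0 r'0.
set r := soft_norm x q; set r' := soft_norm _ q; set a := x i - p q i => e a2 r0 r'0.
rewrite mulrA ler_pdivrMr // mulrBl -expr2 lerBrDr.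
apply: le_of_sqr; first by rewrite mulr_ge0 // ltW.
rewrite exprMn e.
rewrite -subr_ge0 (_ : _ - _ = v ^+ 2 * (r ^+ 2 - a ^+ 2)); last by ring.
by rewrite mulr_ge0 ?sqr_ge0 // subr_ge0.
Qed.

Let soft_norm_shift_le x i v q : (i < n)%N ->
  soft_norm (shift_coord x i v) q - soft_norm x q <=
  v * ((x i - p q i) / soft_norm x q) + v ^+ 2 / delta.
Proof.
move=> ii; have e := soft_norm_shift x v q ii.
have r0 := soft_norm_gt0 x q; have rd := soft_norm_ge_delta x q.
move: e r0 rd.
set r := soft_norm x q; set r' := soft_norm _ q; set a := x i - p q i => e r0 rd.
apply: (@le_trans _ _ (v * (a / r) + v ^+ 2 / r)).
  rewrite mulrA -mulrDl ler_pdivlMr // mulrBl -expr2.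
  have := sqr_ge0 (r' - r); have := sqr_ge0 v; nra.
by rewrite lerD2l ler_wpM2l ?sqr_ge0 // lef_pV2 ?posrE.
Qed.

Let soft_norm_shift_abs x i v q : (i < n)%N ->
  `|soft_norm (shift_coord x i v) q - soft_norm x q| <= `|v|.
Proof.
move=> ii; have e := soft_norm_shift x v q ii; have a2 := coord_le x q ii.
have r0 := soft_norm_gt0 x q; have r'0 := soft_norm_gt0 (shift_coord x i v) q.
move: e a2 r0 r'0.
set r := soft_norm x q; set r' := soft_norm _ q; set a := x i - p q i => e a2 r0 r'0.
have al : `|a| <= r.
  by rewrite -(ger0_norm (ltW r0)) -!sqrtr_sqr ler_wsqrtr.
have va : `|v * a| <= `|v| * r by rewrite normrM ler_wpM2l.
have v2 : v ^+ 2 = `|v| ^+ 2 by rewrite real_normK ?num_real.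
have v0 := normr_ge0 v.
move: va; rewrite !ler_norml => /andP[va1 va2].
rewrite lerBrDr lerBlDr; apply/andP; split.
  have h : r - `|v| <= r'.
    by apply: le_of_sqr; [exact: ltW|rewrite e v2; nra].
  by rewrite addrC.
by apply: le_of_sqr; [rewrite addr_ge0 // ltW|rewrite e v2; nra].
Qed.

(** Jensen's inequality for exp bounds the increment above by the average of the
    increments of the soft norms, and exp z <= 1 + z + 2 z^2 bounds it below. *)
Lemma soft_dist_shift x i v : (i < n)%N -> beta * `|v| <= 2^-1 ->
  `|soft_dist (shift_coord x i v) - soft_dist x - v * soft_grad x i| <=
  (delta^-1 + 2 * beta) * v ^+ 2.
Proof.
move=> ii bv; set x' := shift_coord x i v.
pose D q := soft_norm x' q - soft_norm x q.
have ZZ : Z x' = Z x * \sum_q w x q * expR (- (beta * D q)).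
  rewrite mulr_sumr; apply: eq_bigr => q _.
  rewrite /w mulrA mulrCA mulfV ?gt_eqF // mulr1 -expRD; congr expR; rewrite /D; ring.
have ZZ0 : 0 < \sum_q w x q * expR (- (beta * D q)).
  by rewrite -(pmulr_rgt0 _ (Z_gt0 x)) -ZZ.
have -> : soft_dist x' - soft_dist x =
    - ln (\sum_q w x q * expR (- (beta * D q))) / beta.
  by rewrite /soft_dist ZZ lnM ?posrE // -mulrBl opprD addrAC opprK addNr add0r.
have Dsum : \sum_q w x q * - (beta * D q) = - (beta * \sum_q w x q * D q).
  by rewrite mulr_sumr -sumrN; apply: eq_bigr => q _; ring.
have gr : v * soft_grad x i <= \sum_q w x q * D q.
  rewrite mulr_sumr; apply: ler_sum => q _; rewrite mulrCA ler_wpM2l //.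
  exact: soft_norm_shift_ge.
have gr' : \sum_q w x q * D q <= v * soft_grad x i + v ^+ 2 / delta.
  have -> : v ^+ 2 / delta = \sum_q w x q * (v ^+ 2 / delta).
    by rewrite -mulr_suml w_sum mul1r.
  rewrite mulr_sumr -big_split /=; apply: ler_sum => q _.
  rewrite [v * (_ * _)]mulrCA -mulrDr ler_wpM2l //; exact: soft_norm_shift_le.
have D2 : \sum_q w x q * (- (beta * D q)) ^+ 2 <= (beta * v) ^+ 2.
  rewrite -[leRHS]mul1r -(w_sum x) mulr_suml; apply: ler_sum => q _.
  rewrite ler_wpM2l // sqrrN !exprMn ler_wpM2l ?sqr_ge0 //.
  rewrite -(real_normK (num_real (D q))) -(real_normK (num_real v)).
  by rewrite lerXn2r ?nnegrE // soft_norm_shift_abs.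
have up := average_exp_ge (w_ge0 x) (w_sum x) (fun q => - (beta * D q)).
have lo := @average_exp_le _ _ _ (w_ge0 x) (w_sum x) (fun q => - (beta * D q)).
have {}lo := lo _.
move: up; rewrite -ler_ln ?posrE ?expR_gt0 // expRK Dsum => up.
have {}lo : ln (\sum_q w x q * expR (- (beta * D q))) <=
    - (beta * \sum_q w x q * D q) + 2 * (beta * v) ^+ 2.
  apply: (@le_trans _ _ (- (beta * \sum_q w x q * D q) +
                         2 * \sum_q w x q * (- (beta * D q)) ^+ 2)).
    rewrite -[leRHS]expRK ler_ln ?posrE ?expR_gt0 // -Dsum; apply: lo => q.
    rewrite normrN normrM (gtr0_norm beta0) (le_trans _ bv) // ler_pM2l //.
    exact: soft_norm_shift_abs.
  by rewrite lerD2l ler_pM2l.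
move: up lo; set L := ln _; set S := \sum_q w x q * D q in gr gr' *; set G := soft_grad x i in gr gr' *.
move=> up lo.
have b1 : - L / beta <= S by rewrite ler_pdivrMr // lerNl mulrC.
have b2 : S - 2 * beta * v ^+ 2 <= - L / beta.
  by rewrite ler_pdivlMr //; move: lo; rewrite exprMn; nra.
have v2 := sqr_ge0 v.
have e1 : 0 <= v ^+ 2 / delta by rewrite divr_ge0 // ltW.
have e2 : 0 <= 2 * beta * v ^+ 2 by rewrite mulr_ge0 // mulr_ge0 // ltW.
rewrite mulrDl [delta^-1 * _]mulrC ler_norml.
by apply/andP; split; lra.
Qed.

End soft_distance.

(** * Smoothed indicators of neighbourhoods *)

Section Phi_increment.
Context {R : realType}.
Implicit Types x y s t : R.

Lemma is_derive_phi_le x : `|- (2 * pi * x) * phi x| <= 2 * pi.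
Proof.
have pi0 := pi_gt0 R; have pi2 := pi_ge2 R.
rewrite normrM (gtr0_norm (phi_gt0 x)) normrN !normrM (gtr0_norm pi0) ger0_norm //.
rewrite -mulrA ler_piMr ?mulr_ge0 ?(ltW pi0) //.
have h : (1 + pi * x ^+ 2) * phi x <= 1.
  rewrite /phi expRN ler_pdivrMr ?expR_gt0 // mul1r; exact: expR_ge1Dx.
have a : `|x| <= 1 + pi * x ^+ 2.
  rewrite -(real_normK (num_real x)).
  have h1 : 2 * `|x| ^+ 2 <= pi * `|x| ^+ 2 by rewrite ler_wpM2r ?sqr_ge0.
  have := sqr_ge0 (`|x| - 4^-1); rewrite sqrrB; lra.
by apply: le_trans h; rewrite ler_wpM2r // ltW ?phi_gt0.
Qed.

Lemma phi_lipschitz x y : `|phi y - phi x| <= 2 * pi * `|y - x|.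
Proof.
wlog xy : x y / x <= y => [hw|].
  by case: (leP x y) => [|/ltW] h; [|rewrite distrC [`|y - x|]distrC]; exact: hw.
have [|c _ ->] := @MVT_closed R phi (fun x => - (2 * pi * x) * phi x) x y xy.
  by move=> z _; exact: is_derive_phi.
by rewrite normrM ler_wpM2r // is_derive_phi_le.
Qed.

Lemma Phi_increment_sqr y s :
  (Phi (y + s) - Phi y) ^+ 2 <= (`|s| * phi y + 2 * pi * s ^+ 2) ^+ 2.
Proof.
have pi0 := pi_gt0 R.
have h : `|Phi (y + s) - Phi y| <= `|s| * phi y + 2 * pi * s ^+ 2.
  have [c cs ->] := MVT_between (a := y) (b := y + s) (fun x _ => is_derive_Phi x).
  have {}cs : `|c - y| <= `|s|.
    by have := between_abs cs; rewrite [y + s]addrC addrK.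
  rewrite [y + s]addrC addrK.
  rewrite normrM (gtr0_norm (phi_gt0 c)) mulrC.
  rewrite -(real_normK (num_real s)) expr2 [X in _ <= _ + X]mulrCA -mulrDr ler_wpM2l //.
  have := phi_lipschitz y c; move/ler_normlP => [_ l].
  have : 2 * pi * `|c - y| <= 2 * pi * `|s| by rewrite ler_pM2l ?mulr_gt0.
  lra.
have nn : 0 <= `|s| * phi y + 2 * pi * s ^+ 2 by exact: le_trans h.
by rewrite -(real_normK (num_real (_ - _))) lerXn2r ?nnegrE.
Qed.

End Phi_increment.

Section soft_indicator.
Context {R : realType} {I : finType}.
Variables (n : nat) (p : I -> nat -> R) (delta beta lambda : R).
Hypotheses (delta0 : 0 < delta) (beta0 : 0 < beta) (lambda0 : 0 < lambda).
Hypothesis I0 : (0 < #|I|)%N.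

Local Notation rho := (soft_dist n p delta beta).

Definition soft_indicator (c : R) (x : nat -> R) : R := Phi (lambda * (c - rho x)).

Lemma soft_indicator01 c x : 0 < soft_indicator c x < 1.
Proof. by rewrite Phi_gt0 Phi_lt1. Qed.

Lemma profile_soft_indicator c x :
  profile (soft_indicator c x) = phi (lambda * (c - rho x)).
Proof. by rewrite /profile PhiK. Qed.

(** To first order the increment is lambda phi v times the partial derivative of
    soft_dist. The cubic error term is uniform in c and x, so that it disappears when
    the mesh of the partition tends to 0. *)
Lemma soft_indicator_shift : exists L w0 : R, [/\ 0 <= L, 0 < w0 &
  forall c x i v, (i < n)%N -> `|v| <= w0 ->
  (soft_indicator c (shift_coord x i v) - soft_indicator c x) ^+ 2 <=
  lambda ^+ 2 * profile (soft_indicator c x) ^+ 2 * v ^+ 2 *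
    soft_grad n p delta beta x i ^+ 2 + L * `|v| ^+ 3].
Proof.
pose C := delta^-1 + 2 * beta.
have C0 : 0 < C by rewrite addr_gt0 ?invr_gt0 ?mulr_gt0.
pose B := lambda * (1 + C).
have B0 : 0 < B by rewrite mulr_gt0 // addr_gt0.
have pi0 := pi_gt0 R.
have c1 : 0 <= 2 * C + C ^+ 2.
  by apply: addr_ge0; [apply: mulr_ge0 => //; exact: ltW|exact: sqr_ge0].
have c2 : 0 <= 4 * pi + 4 * pi ^+ 2 * B.
  have h := exprn_gt0 2 pi0.
  by apply: addr_ge0; [exact/ltW/mulr_gt0|exact/ltW/mulr_gt0/B0/mulr_gt0].
exists (lambda ^+ 2 * (2 * C + C ^+ 2) + (4 * pi + 4 * pi ^+ 2 * B) * B ^+ 3).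
exists (Num.min 1 (2^-1 / beta)); split.
- by rewrite addr_ge0 // mulr_ge0 ?sqr_ge0 // exprn_ge0 // ltW.
- by rewrite lt_min ltr01 divr_gt0.
move=> c x i v ii; rewrite le_min => /andP[v1 vb].
have {}vb : beta * `|v| <= 2^-1 by rewrite mulrC -ler_pdivlMr.
have sh := soft_dist_shift p delta0 beta0 I0 x ii vb.
rewrite -/C in sh.
set x' := shift_coord x i v in sh *.
set g := soft_grad n p delta beta x i in sh *.
have g1 : `|g| <= 1.
  have : g ^+ 2 <= 1.
    apply: le_trans (soft_grad_sqr_sum n p beta delta0 I0 x).
    by rewrite (bigD1 (Ordinal ii)) //= lerDl sumr_ge0 // => ? _; exact: sqr_ge0.
  by rewrite -(real_normK (num_real g)) expr_le1.
rewrite profile_soft_indicator /soft_indicator.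
move: (rho x') (rho x) sh => r' r sh; pose y := lambda * (c - r).
rewrite -/y; pose t := r' - r; rewrite -/t in sh.
have -> : lambda * (c - r') = y + - (lambda * t) by rewrite /y /t; ring.
apply: le_trans (Phi_increment_sqr _ _) _.
have f0 := phi_gt0 y; have f1 := phi_le1 y.
move: (phi y) f0 f1 => f f0 f1.
rewrite normrN normrM (gtr0_norm lambda0) sqrrN.
have V0 := normr_ge0 v.
have v2 : v ^+ 2 = `|v| ^+ 2 by rewrite real_normK ?num_real.
have g2 : g ^+ 2 = `|g| ^+ 2 by rewrite real_normK ?num_real.
have t2 : t ^+ 2 = `|t| ^+ 2 by rewrite real_normK ?num_real.
have T0 := normr_ge0 t; have G0 := normr_ge0 g.
have tle : `|t| <= `|v| * (`|g| + C * `|v|).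
  rewrite -[t](subrK (v * g)); apply: le_trans (ler_normD _ _) _.
  rewrite normrM mulrDr addrC lerD2l; apply: le_trans sh _; rewrite v2; lra.
rewrite exprMn t2 v2 g2.
move: V0 T0 G0 tle g1 v1; clear -f0 f1 C0 lambda0 pi0 B0 c1 c2.
move: `|v| `|t| `|g| => V T G V0 T0 G0 tle G1 V1.
have TB : lambda * T <= B * V.
  rewrite /B -mulrA ler_pM2l // mulrC; apply: le_trans tle _.
  rewrite ler_wpM2l // lerD //; nra.
have T2 : T ^+ 2 <= V ^+ 2 * G ^+ 2 + (2 * C + C ^+ 2) * V ^+ 3.
  apply: (@le_trans _ _ ((V * (G + C * V)) ^+ 2)); first by rewrite lerXn2r ?nnegrE ?(le_trans T0 tle).
  rewrite -subr_ge0.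
  have -> : V ^+ 2 * G ^+ 2 + (2 * C + C ^+ 2) * V ^+ 3 - (V * (G + C * V)) ^+ 2 =
    V ^+ 3 * (2 * C * (1 - G) + C ^+ 2 * (1 - V)) by ring.
  apply: mulr_ge0; first exact: exprn_ge0.
  apply: addr_ge0; apply: mulr_ge0; rewrite ?subr_ge0 ?sqr_ge0 //.
  by rewrite mulr_ge0 // ltW.
set S := lambda * T in TB.
have S0 : 0 <= S by rewrite mulr_ge0 // ltW.
have -> : lambda ^+ 2 * T ^+ 2 = S ^+ 2 by rewrite exprMn.
have -> : (S * f + 2 * pi * S ^+ 2) ^+ 2 =
    lambda ^+ 2 * f ^+ 2 * T ^+ 2 + (4 * pi * f + 4 * pi ^+ 2 * S) * S ^+ 3.
  by rewrite /S; ring.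
have S3 : S ^+ 3 <= B ^+ 3 * V ^+ 3.
  by rewrite -exprMn lerXn2r ?nnegrE // mulr_ge0 // ltW.
have SB : S <= B by apply: le_trans TB _; rewrite ler_piMr // ltW.
have e1 : (4 * pi * f + 4 * pi ^+ 2 * S) * S ^+ 3 <=
    (4 * pi + 4 * pi ^+ 2 * B) * (B ^+ 3 * V ^+ 3).
  apply: ler_pM => //.
  - apply: addr_ge0; apply: mulr_ge0 => //.
    + by rewrite mulr_ge0 // ltW.
    + exact: ltW.
    + by rewrite mulr_ge0 // sqr_ge0.
  - by rewrite exprn_ge0.
  - rewrite lerD //; first by rewrite ler_piMr // mulr_ge0 // ltW.
    by rewrite ler_wpM2l // mulr_ge0 ?sqr_ge0.
have l2 : 0 <= lambda ^+ 2 by exact: sqr_ge0.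
have f2 : 0 <= f ^+ 2 <= 1 by rewrite sqr_ge0 expr_le1 // ltW.
have e2 : lambda ^+ 2 * f ^+ 2 * T ^+ 2 <= lambda ^+ 2 * f ^+ 2 * V ^+ 2 * G ^+ 2 +
    lambda ^+ 2 * (2 * C + C ^+ 2) * V ^+ 3.
  have /andP[f20 f21] := f2.
  apply: (@le_trans _ _ (lambda ^+ 2 * f ^+ 2 * (V ^+ 2 * G ^+ 2 + (2 * C + C ^+ 2) * V ^+ 3))).
    by rewrite ler_wpM2l // mulr_ge0.
  rewrite mulrDr; apply: lerD; first by rewrite mulrA.
  rewrite -[leLHS]mulrA -[leRHS]mulrA; apply: ler_wpM2l => //; apply: ler_piMl => //.
  by rewrite mulr_ge0 ?exprn_ge0.
apply: le_trans (lerD e2 e1) _.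
by rewrite le_eqVlt; apply/orP; left; apply/eqP; ring.
Qed.

End soft_indicator.

(** * The binomial partition of the unit interval *)

Section grid.
Context {R : realType}.
Implicit Types N k m n : nat.

Definition max_weight m : R := 'C(m.*2, m)%:R / 4 ^+ m.

Let bin_le_next m k : (k < m)%N -> ('C(m.*2, k) <= 'C(m.*2, k.+1))%N.
Proof.
move=> km; rewrite -(leq_pmul2l (ltn0Sn k)) mul_bin_left leq_mul2r; lia.
Qed.

Let bin_le_lower m k : (k <= m)%N -> ('C(m.*2, k) <= 'C(m.*2, m))%N.
Proof.
move=> km; rewrite -(subKn km); elim: (m - k)%N (leq_subr k m) => [|j IH] jm.
  by rewrite subn0.
apply: leq_trans (IH (ltnW jm)).
have -> : (m - j = (m - j.+1).+1)%N by lia.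
by apply: bin_le_next; lia.
Qed.

Lemma bin_weight_le m k : bin_weight m.*2 k <= max_weight m :> R.
Proof.
rewrite /bin_weight /max_weight -mul2n exprM -natrX ler_pM2r; last first.
  by rewrite invr_gt0 exprn_gt0 // ltr0n.
rewrite ler_nat mul2n.
have [km|mk] := leqP k m; first exact: bin_le_lower.
have [k2|k2] := leqP k m.*2; last by rewrite bin_small.
by rewrite -bin_sub //; apply: bin_le_lower; lia.
Qed.

Lemma bin_weight_ge0 N k : 0 <= bin_weight N k :> R.
Proof. by rewrite divr_ge0 // exprn_ge0. Qed.

Lemma max_weight_ge0 m : 0 <= max_weight m.
Proof. by rewrite divr_ge0 // exprn_ge0. Qed.

(** Point k of the partition of [0, 1] into intervals whose lengths are the binomial
    weights *)
Definition grid_point N k : R := \sum_(j < k) bin_weight N j.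

Lemma grid_point0 N : grid_point N 0 = 0. Proof. exact: big_ord0. Qed.

Lemma grid_pointS N k : grid_point N k.+1 = grid_point N k + bin_weight N k.
Proof. exact: big_ord_recr. Qed.

Lemma grid_point1 N : grid_point N N.+1 = 1.
Proof.
rewrite /grid_point /bin_weight -mulr_suml -natr_sum.
have -> : (\sum_(i < N.+1) 'C(N, i) = 2 ^ N)%N.
  rewrite (Pascal 1 1 N).
  by apply: eq_bigr => i _; rewrite !exp1n !muln1.
by rewrite natrX mulfV // expf_neq0 // pnatr_eq0.
Qed.

Definition grid N (s : seq nat) : nat -> R := fun i => grid_point N (nth 0%N s i).

Lemma grid_succ N s i :
  grid N (set_nth 0%N s i (nth 0%N s i).+1) =
  shift_coord (grid N s) i (bin_weight N (nth 0%N s i)).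
Proof.
apply/funext => j; rewrite /grid /shift_coord nth_set_nth /=.
by case: eqP => // _; rewrite grid_pointS.
Qed.

Lemma grid_pred N s i : exists2 v,
  `|v| <= bin_weight N (nth 0%N s i).-1 &
  grid N (set_nth 0%N s i (nth 0%N s i).-1) = shift_coord (grid N s) i v.
Proof.
case e : (nth 0%N s i) => [|k].
  (* the predecessor of 0 is 0, so that the point does not move *)
  exists 0; first by rewrite normr0 bin_weight_ge0.
  apply/funext => j; rewrite /grid /shift_coord nth_set_nth /=.
  by case: eqP => // _; rewrite e addr0.
exists (- bin_weight N k); first by rewrite normrN ger0_norm ?bin_weight_ge0.
apply/funext => j; rewrite /grid /shift_coord nth_set_nth /=.
by case: eqP => // _; rewrite e grid_pointS addrK.
Qed.

Lemma binomial_mean_le N n (f g : seq nat -> R) :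
  (forall s, size s = n -> all (fun k => k <= N)%N s -> f s <= g s) ->
  binomial_mean N n f <= binomial_mean N n g.
Proof.
elim: n f g => [|n IH] f g fg /=; first exact: fg.
apply: ler_sum => k _; rewrite ler_wpM2l ?bin_weight_ge0 //.
apply: IH => s sn sN; apply: fg; first by rewrite /= sn.
by rewrite /= sN -ltnS ltn_ord.
Qed.

Lemma is_derive_binomial_mean N n (F : R -> seq nat -> R) (F' : seq nat -> R)
    (c : R) : (forall s, is_derive c 1 (F ^~ s) (F' s)) ->
  is_derive c 1 (fun c => binomial_mean N n (F c)) (binomial_mean N n F').
Proof.
elim: n F F' => [|n IH] F F' dF /=; first exact: dF.
rewrite /bin_prod /binE.
have d (k : 'I_N.+1) : is_derive c 1 (fun c => bin_weight N k *
    binomial_mean N n (fun s => F c (val k :: s)))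
    (bin_weight N k * binomial_mean N n (fun s => F' (val k :: s))).
  have h : is_derive c 1 (fun c => binomial_mean N n (fun s => F c (val k :: s)))
    (binomial_mean N n (fun s => F' (val k :: s))) by apply: IH => s; exact: dF.
  exact: is_deriveZ.
have := is_derive_sum d.
by congr (is_derive _ _ _ _); apply/funext => x; rewrite fct_sumE.
Qed.

End grid.

Section discrete_isoperimetry.
Context {R : realType} {I : finType}.
Variables (n : nat) (p : I -> nat -> R) (delta beta lambda : R).
Hypotheses (delta0 : 0 < delta) (beta0 : 0 < beta) (lambda0 : 0 < lambda).
Hypothesis I0 : (0 < #|I|)%N.

Local Notation rho := (soft_dist n p delta beta).
Local Notation F := (soft_indicator n p delta beta lambda).
Local Notation E m := (binomial_mean m.*2 n).

(** The bound N w^2 <= 2 / pi on the largest weight w turns the discrete energy into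
    the squared gradient. *)
Lemma soft_indicator_energy : exists L w0 : R, [/\ 0 <= L, 0 < w0 &
  forall m c s, (0 < m)%N -> max_weight m <= w0 -> size s = n ->
  all (fun k => k <= m.*2)%N s ->
  binomial_energy m.*2 n (fun s => F c (grid m.*2 s)) s <=
  lambda ^+ 2 * profile (F c (grid m.*2 s)) ^+ 2 + L * max_weight m].
Proof.
have [L [w0 [L0 w00 h]]] := soft_indicator_shift n p delta0 beta0 lambda0 I0.
exists (n%:R * L), w0; split => // [|m c s m0 mw sn sN]; first by rewrite mulr_ge0.
have pi0 := pi_gt0 R.
set w := max_weight m in mw *.
have wge0 : 0 <= w by exact: max_weight_ge0.
set x := grid m.*2 s.
set J := profile (F c x).
pose a i := lambda ^+ 2 * J ^+ 2 * w ^+ 2 * soft_grad n p delta beta x i ^+ 2 + L * w ^+ 3.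
have step i v : (i < n)%N -> `|v| <= w ->
    (F c (shift_coord x i v) - F c x) ^+ 2 <= a i.
  move=> ii vw; apply: le_trans (h c x i v ii (le_trans vw mw)) _.
  rewrite lerD //; last by rewrite ler_wpM2l // lerXn2r ?nnegrE.
  apply: ler_wpM2r; first exact: sqr_ge0.
  apply: ler_wpM2l; first by rewrite mulr_ge0 ?sqr_ge0.
  by rewrite -(real_normK (num_real v)) lerXn2r ?nnegrE.
have w2 : pi / 2 * (m.*2)%:R * w ^+ 2 <= 1.
  have := @central_bin_le R m m0; rewrite -/(max_weight m) -/w.
  rewrite -(ler_pM2l (x := pi * m%:R)) ?mulr_gt0 ?ltr0n // mulfV; last first.
    by rewrite mulf_neq0 ?pnatr_eq0 -?lt0n // gt_eqF.
  by rewrite -mul2n natrM mulrA divfK ?pnatr_eq0.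
apply: (@le_trans _ _ (pi / 2 * (m.*2)%:R * \sum_(i < n) a i)).
  apply: (binomial_energy_le (a := a)) => // i ii; split.
    have [v vw ->] := @grid_pred R m.*2 s i.
    rewrite -sqrrN opprB; apply: step => //.
    exact: le_trans vw (bin_weight_le _ _).
  rewrite grid_succ; apply: step => //.
  by rewrite ger0_norm ?bin_weight_ge0 // bin_weight_le.
rewrite /a big_split /= -mulr_sumr sumr_const card_ord -[_ *+ n]mulr_natl.
have K0 : 0 <= pi / 2 * (m.*2)%:R :> R by rewrite mulr_ge0 // divr_ge0 // ltW.
apply: (@le_trans _ _ (pi / 2 * (m.*2)%:R * w ^+ 2 *
    (lambda ^+ 2 * J ^+ 2 + n%:R * L * w))).
  rewrite -[leRHS]mulrA ler_wpM2l // [leRHS]mulrDr lerD //; last first.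
    by rewrite le_eqVlt; apply/orP; left; apply/eqP; ring.
  rewrite [w ^+ 2 * _]mulrC ler_piMr ?soft_grad_sqr_sum //.
  by apply: mulr_ge0; [apply: mulr_ge0|]; exact: sqr_ge0.
by rewrite ler_piMl // addr_ge0 // mulr_ge0 ?sqr_ge0 ?mulr_ge0.
Qed.

Let sqrtD (a b : R) : 0 <= a -> 0 <= b ->
  Num.sqrt (a + b) <= Num.sqrt a + Num.sqrt b.
Proof.
move=> a0 b0; rewrite -[leRHS]ger0_norm ?addr_ge0 ?sqrtr_ge0 // -sqrtr_sqr.
rewrite ler_wsqrtr // sqrrD !sqr_sqrtr // addrAC lerDl mulrn_wge0 // mulr_ge0 ?sqrtr_ge0 //.
Qed.

(** The gradient of the soft indicator is at most lambda times its profile, so the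
    square root in Bobkov's inequality becomes sqrt (1 + lambda^2) times the profile. *)
Lemma soft_indicator_isoperimetry : exists L w0 : R, [/\ 0 <= L, 0 < w0 &
  forall m c, (0 < m)%N -> max_weight m <= w0 ->
  profile (E m (fun s => F c (grid m.*2 s))) <=
  Num.sqrt (1 + lambda ^+ 2) * E m (fun s => profile (F c (grid m.*2 s))) +
  Num.sqrt (L * max_weight m)].
Proof.
have [L [w0 [L0 w00 h]]] := soft_indicator_energy.
exists L, w0; split => // m c m0 mw.
have hE := @binomial_meanP R m.*2 n.
apply: le_trans (binomial_bobkov _ _ (f := fun s => F c (grid m.*2 s)) _) _.
  by move=> s; exact: soft_indicator01.
apply: (@le_trans _ _ (E m (fun s => Num.sqrt (1 + lambda ^+ 2) *
    profile (F c (grid m.*2 s)) + Num.sqrt (L * max_weight m)))).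
  apply: binomial_mean_le => s sn sN.
  apply: (@le_trans _ _ (Num.sqrt ((1 + lambda ^+ 2) *
      profile (F c (grid m.*2 s)) ^+ 2 + L * max_weight m))).
    by rewrite ler_wsqrtr // mulrDl mul1r -addrA lerD2l h.
  apply: le_trans (sqrtD _ _) _.
  - by rewrite mulr_ge0 ?sqr_ge0 // addr_ge0 ?sqr_ge0.
  - by rewrite mulr_ge0 ?max_weight_ge0.
  rewrite sqrtrM ?addr_ge0 ?sqr_ge0 // sqrtr_sqr ger0_norm //.
  exact/ltW/profile_gt0.
by rewrite meanD // mean_scale // mean_cst.
Qed.

End discrete_isoperimetry.

(** * Growth of the neighbourhoods *)

Section growth.
Context {R : realType} {I : finType}.
Variables (n : nat) (p : I -> nat -> R) (delta beta lambda : R).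
Variables (m : nat) (eta : R).
Hypotheses (lambda0 : 0 < lambda) (eta0 : 0 <= eta).

Local Notation rho := (soft_dist n p delta beta).
Local Notation F := (soft_indicator n p delta beta lambda).
Local Notation E := (binomial_mean m.*2 n).
Local Notation x := (grid m.*2).

Hypothesis isoperimetry : forall c,
  profile (E (fun s => F c (x s))) <=
  Num.sqrt (1 + lambda ^+ 2) * E (fun s => profile (F c (x s))) + eta.

Let M c := E (fun s => F c (x s)).
Let kappa := lambda / Num.sqrt (1 + lambda ^+ 2).

Let hE : @mean R _ E. Proof. exact: binomial_meanP. Qed.

Let M01 c : 0 < M c < 1.
Proof. by apply: mean01 => // s; exact: soft_indicator01. Qed.

Let is_derive_M (c : R) : is_derive c 1 M (lambda * E (fun s => profile (F c (x s)))).
Proof.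
rewrite -mean_scale //; apply: is_derive_binomial_mean => s.
rewrite profile_soft_indicator /soft_indicator.
move: (rho (x s)) => r.
have h : is_derive c 1 (fun c => lambda * (c - r)) lambda.
  by apply: is_derive_eq; rewrite /GRing.scale /=; ring.
have := @is_derive1_comp R Phi (fun c => lambda * (c - r)) c _ _ (is_derive_Phi _) h.
by rewrite mulrC.
Qed.

Let M' (c : R) : R := lambda * E (fun s => profile (F c (x s))) / profile (M c).

Let is_derive_level (c : R) : is_derive c 1 (Phi_inv \o M) (M' c).
Proof.
rewrite /M' mulrC; apply: is_derive1_comp; last exact: is_derive_M.
exact: is_derive_Phi_inv.
Qed.

Let M'_ge0 c : 0 <= M' c.
Proof.
apply: mulr_ge0; last by rewrite invr_ge0 ltW // profile_gt0.
rewrite mulr_ge0 ?(ltW lambda0) //; case: hE => _ _ + _; apply => s.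
exact/ltW/profile_gt0.
Qed.

Let M'_ge c : kappa * (1 - eta / profile (M c)) <= M' c.
Proof.
have J0 := profile_gt0 (M c).
rewrite /M' ler_pdivlMr // -mulrA mulrBl mul1r divfK ?gt_eqF //.
have s0 : 0 < Num.sqrt (1 + lambda ^+ 2) by rewrite sqrtr_gt0 ltr_pwDl // sqr_ge0.
rewrite /kappa -mulrA ler_pM2l // mulrC ler_pdivrMr // lerBlDr mulrC.
exact: isoperimetry.
Qed.

(** The derivative of Phi_inv (M c) is lambda times the mean of the profile, divided by
    the profile of M c; the hypothesis bounds it below by kappa up to the error eta.
    As long as the level stays in [- theta, theta], the profile of M c is at least
    phi theta. *)
Lemma level_growth c1 c2 theta : c1 <= c2 ->
  - theta <= Phi_inv (M c1) -> Phi_inv (M c2) <= theta ->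
  kappa * (1 - eta / phi theta) * (c2 - c1) <= 2 * theta.
Proof.
move=> c12 t1 t2.
have mono a b : a <= b -> Phi_inv (M a) <= Phi_inv (M b).
  move=> ab; apply: (@derive_ge0_le R (Phi_inv \o M) M' a b ab) => c _.
    exact: is_derive_level.
  exact: M'_ge0.
have [|c /andP[ac cb] e] := @MVT_closed R (Phi_inv \o M) M' c1 c2 c12.
  by move=> c _; exact: is_derive_level.
have {e} /= e : Phi_inv (M c2) - Phi_inv (M c1) = M' c * (c2 - c1) := e.
apply: (@le_trans _ _ (M' c * (c2 - c1))); last by rewrite -e; lra.
rewrite ler_wpM2r ?subr_ge0 //; apply: le_trans (M'_ge c).
have k0 : 0 <= kappa by rewrite divr_ge0 ?sqrtr_ge0 // ltW.
rewrite ler_wpM2l // lerD2l lerN2 ler_wpM2l //.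
rewrite lef_pV2 ?posrE ?phi_gt0 ?profile_gt0 //.
rewrite /profile /phi ler_expR lerN2 ler_wpM2l ?pi_ge0 //.
have h1 : - theta <= Phi_inv (M c) by apply: le_trans t1 (mono _ _ ac).
have h2 : Phi_inv (M c) <= theta by apply: le_trans (mono _ _ cb) t2.
have h : `|Phi_inv (M c)| <= theta by rewrite ler_norml h1 h2.
rewrite -(real_normK (num_real (Phi_inv _))) lerXn2r ?nnegrE //.
exact: le_trans h.
Qed.

(** On A the soft indicator is at least Phi (lambda sigma) at c = alpha + sigma, and on B
    its complement is so at c = D - sigma: the levels at these two points are at least
    - theta and at most theta. *)
Lemma two_sets_growth (A B : seq nat -> bool) (eps theta alpha D sigma : R) :
  E (fun s => (A s)%:R) >= eps -> E (fun s => (B s)%:R) >= eps ->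
  Phi (- theta) <= eps * Phi (lambda * sigma) ->
  (forall s, A s -> rho (x s) <= alpha) ->
  (forall s, B s -> D <= rho (x s)) ->
  alpha + sigma <= D - sigma ->
  kappa * (1 - eta / phi theta) * (D - alpha - 2 * sigma) <= 2 * theta.
Proof.
move=> eA eB th hA hB ab.
have P0 := Phi_ge0 (lambda * sigma).
rewrite (_ : D - alpha - 2 * sigma = (D - sigma) - (alpha + sigma)); last by ring.
apply: level_growth => //.
  rewrite -[- theta]PhiK Phi_inv_le ?Phi_gt0 ?Phi_lt1 //.
  apply: le_trans th _; apply: (@le_trans _ _ (E (fun s => Phi (lambda * sigma) * (A s)%:R))).
    by rewrite mean_scale // mulrC ler_wpM2l.
  apply: mean_le => // s; case As : (A s); last first.
    by rewrite mulr0 /soft_indicator Phi_ge0.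
  rewrite mulr1 Phi_mono ler_pM2l // lerBrDr addrC lerD2r; exact: hA.
rewrite -[theta]PhiK Phi_inv_le ?Phi_gt0 ?Phi_lt1 //.
rewrite -[theta]opprK PhiN lerBrDr -lerBrDl.
apply: le_trans th _; apply: (@le_trans _ _ (E (fun s => Phi (lambda * sigma) * (B s)%:R))).
  by rewrite mean_scale // mulrC ler_wpM2l.
have -> : 1 - M (D - sigma) = E (fun s => 1 - F (D - sigma) (x s)).
  by rewrite meanB // mean_cst.
apply: mean_le => // s; rewrite /soft_indicator -PhiN; case Bs : (B s); last first.
  by rewrite mulr0 Phi_ge0.
rewrite mulr1 Phi_mono -mulrN ler_pM2l //; have := hB s Bs; lra.
Qed.

End growth.

(** * Euclidean norm and volume of cells *)

Section euclidean_norm.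
Context {R : realType} {n : nat}.
Implicit Types f g : 'I_n -> R.

Definition enorm f : R := Num.sqrt (\sum_i f i ^+ 2).

Let sumsqr_ge0 f : 0 <= \sum_i f i ^+ 2.
Proof. by apply: sumr_ge0 => i _; exact: sqr_ge0. Qed.

Lemma cauchy_schwarz f g : \sum_i f i * g i <= enorm f * enorm g.
Proof.
set A := \sum_i f i ^+ 2; set B := \sum_i g i ^+ 2; set C := \sum_i f i * g i.
have A0 : 0 <= A by exact: sumsqr_ge0.
have B0 : 0 <= B by exact: sumsqr_ge0.
rewrite /enorm -sqrtrM //; apply: le_trans (ler_norm _) _; rewrite -sqrtr_sqr ler_wsqrtr //.
have h : 0 <= B * (A * B - C ^+ 2).
  have <- : \sum_i (B * f i - C * g i) ^+ 2 = B * (A * B - C ^+ 2).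
    have -> : \sum_i (B * f i - C * g i) ^+ 2 =
        \sum_i ((B ^+ 2 * f i ^+ 2 + C ^+ 2 * g i ^+ 2) - 2 * B * C * (f i * g i)).
      by apply: eq_bigr => i _; ring.
    by rewrite sumrB big_split /= -!mulr_sumr -/A -/B -/C; ring.
  exact: sumsqr_ge0.
move: B0; rewrite le_eqVlt => /predU1P[B0|B0]; last by move: h; rewrite pmulr_rge0 // subr_ge0.
suff -> : C = 0 by rewrite expr0n mulr_ge0 // -B0.
rewrite /C big1 // => i _; suff -> : g i = 0 by rewrite mulr0.
apply/eqP; rewrite -sqrf_eq0; apply/eqP.
by apply: (psumr_eq0P (P := xpredT) (F := fun i => g i ^+ 2)) => // j _; exact: sqr_ge0.
Qed.

Lemma enorm_triangle f g : enorm (fun i => f i + g i) <= enorm f + enorm g.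
Proof.
have f0 : 0 <= enorm f by exact: sqrtr_ge0.
have g0 : 0 <= enorm g by exact: sqrtr_ge0.
rewrite -[leRHS]ger0_norm ?addr_ge0 // -sqrtr_sqr ler_wsqrtr //.
have -> : \sum_i (f i + g i) ^+ 2 =
    \sum_i f i ^+ 2 + \sum_i g i ^+ 2 + 2 * \sum_i f i * g i.
  rewrite mulr_sumr -!big_split /=; apply: eq_bigr => i _; ring.
have := cauchy_schwarz f g; rewrite sqrrD !sqr_sqrtr //; lra.
Qed.

Lemma enorm_le f (b : R) : 0 <= b -> (forall i, `|f i| <= b) ->
  enorm f <= Num.sqrt n%:R * b.
Proof.
move=> b0 h; rewrite -[X in _ * X]ger0_norm // -sqrtr_sqr -sqrtrM // ler_wsqrtr //.
rewrite -[X in X%:R]card_ord mulr_natl -sumr_const; apply: ler_sum => i _.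
by rewrite -(real_normK (num_real (f i))) lerXn2r ?nnegrE.
Qed.

End euclidean_norm.

Section cells.
Context {R : realType}.

Definition in_cell N n (s : seq nat) (x : n.-tuple R) : Prop :=
  [/\ size s = n, all (fun k => k <= N)%N s &
   forall i : 'I_n, grid N s i <= tnth x i < grid_point N (nth 0%N s i).+1].

Let grid_point_cell N M (y : R) : 0 <= y < grid_point N M ->
  exists2 k, (k < M)%N & grid_point N k <= y < grid_point N k.+1.
Proof.
elim: M => [|M IH]; first by rewrite grid_point0 => /andP[/le_lt_trans h /h]; rewrite ltxx.
move=> /andP[y0 yM]; have [h|h] := leP (grid_point N M) y.
  by exists M => //; rewrite h.
by have [|k kM hk] := IH; [rewrite y0|exists k => //; exact: ltnW].
Qed.

Lemma cell_exists N n (x : n.-tuple R) : unit_cube x ->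
  exists t : n.-tuple 'I_N.+1, in_cell N [seq val k | k <- t] x.
Proof.
move=> cx.
have h (i : 'I_n) : exists k : 'I_N.+1,
    grid_point N k <= tnth x i < grid_point N k.+1.
  have /andP[x0 x1] := cx i.
  have [|k kN hk] := @grid_point_cell N N.+1 (tnth x i).
    by rewrite grid_point1 ltW.
  by exists (Ordinal kN).
have [k hk] := choice h.
exists [tuple k i | i < n]; split.
- by rewrite size_map size_tuple.
- by apply/allP => _ /mapP[j _ ->]; rewrite -ltnS ltn_ord.
- move=> i; rewrite /grid (nth_map ord0) ?size_tuple //.
  by rewrite -(tnth_nth ord0) tnth_mktuple; exact: hk.
Qed.

Lemma in_cell_close N n (s : seq nat) (x : n.-tuple R) i : in_cell N s x ->
  `|tnth x i - grid N s i| <= bin_weight N (nth 0%N s i).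
Proof.
move=> [_ _ /(_ i)/andP[h1 h2]]; rewrite ger0_norm ?subr_ge0 //.
by rewrite lerBlDr addrC -grid_pointS ltW.
Qed.

Definition cell_union N n (P : seq nat -> bool) : set (n.-tuple R) :=
  [set x | exists2 s, P s & in_cell N s x].

Let slice N n (P : seq nat -> bool) k : set (n.+1.-tuple R) :=
  [set x | grid_point N k <= tnth x ord0 < grid_point N k.+1 /\
           cell_union N (fun s => P (k :: s)) [tuple of behead x]].

Let cell_unionS N n P :
  @cell_union N n.+1 P = \big[setU/set0]_(k < N.+1) @slice N n P k.
Proof.
rewrite -bigcup_mkord; apply/seteqP; split => x.
  move=> [[|k s] Ps [//= [sn] /andP[kN sN] h]]; exists k => //; split.
    by have := h ord0; rewrite /grid /=.
  exists s => //; split => // i; have := h (lift ord0 i).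
  by rewrite /grid /= !(tnth_nth 0) /= nth_behead.
move=> [k /= kN] [hk [s Ps [sn sN h]]]; exists (k :: s) => //; split => /=.
- by rewrite sn.
- by rewrite sN -ltnS kN.
move=> i; have [j ->|->] := unliftP ord0 i; last by rewrite /grid.
by have := h j; rewrite /grid /= !(tnth_nth 0) /= nth_behead.
Qed.

Let slice_preimage N n P k : @slice N n P k =
  ((fun x : n.+1.-tuple R => tnth x ord0) @^-1` [set` `[grid_point N k, grid_point N k.+1[]) `&`
  ((fun x : n.+1.-tuple R => [tuple of behead x]) @^-1`
     (cell_union N (fun s => P (k :: s)))).
Proof. by apply/seteqP; split => x; rewrite /slice /preimage /= in_itv. Qed.

(** Slicing along the first coordinate, the volume of a union of cells obeys the
    recursion that defines the binomial mean. *)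
Lemma cell_union_measure N n P : measurable (@cell_union N n P) /\
  (lebesgue_prod (@cell_union N n P) <= (binomial_mean N n (fun s => (P s)%:R))%:E)%E.
Proof.
elim: n P => [|n IH] P /=.
  have e : @cell_union N 0 P = if P [::] then setT else set0.
    case: ifP => P0; apply/seteqP; split => // x.
      by move=> _; exists [::] => //; split => // -[].
    by move=> [s Ps [/size0nil s0 _ _]]; move: Ps; rewrite s0 P0.
  rewrite e; case: ifP => _; first by split => //; rewrite diracT.
  by split => //; rewrite dirac0.
have mS k : measurable (@slice N n P k).
  rewrite slice_preimage; apply: measurableI.
    rewrite -[X in measurable X]setTI; apply: (@measurable_tnth _ R n.+1 ord0) => //.
  rewrite -[X in measurable X]setTI; apply: measurable_behead => //.
  by have [] := IH (fun s => P (k :: s)).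
rewrite cell_unionS; split; first by apply: bigsetU_measurable => k _; exact: mS.
apply: le_trans (Boole_inequality (@lebesgue_prod R n.+1) (A := @slice N n P) (fun k _ => mS k)) _.
rewrite /bin_prod /binE -sumEFin; apply: lee_sum => k _.
have [mC C] := IH (fun s => P (val k :: s)).
set T := cell_union N (fun s => P (val k :: s)) in mC C.
suff : (lebesgue_prod (@slice N n P k) <= (bin_weight N k *
    binomial_mean N n (fun s => (P (val k :: s))%:R))%:E)%E by [].
have -> : lebesgue_prod (@slice N n P k) =
    (lebesgue_measure ([set` `[grid_point N k, grid_point N k.+1[] : set R) *
     lebesgue_prod T)%E.
  rewrite -(product_measure1E lebesgue_measure (@lebesgue_prod R n) _ mC) //.
  rewrite /= /pushforward; congr (product_measure1 _ _ _).
  apply/seteqP; split => [[a t]|[a t]] /=; rewrite in_itv /= /slice /=.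
    by move=> [h1 h2]; split => //; move: h2; congr T; apply/val_inj.
  by move=> [h1 h2]; split => //; move: h2; congr T; apply/val_inj.
rewrite lebesgue_measure_itv /= lte_fin grid_pointS.
case: ifPn => [_|_]; last first.
  rewrite mul0e lee_fin mulr_ge0 ?bin_weight_ge0 //.
  by case: (@binomial_meanP R N n) => _ _ + _; apply => s.
rewrite -EFinD addrAC subrr add0r [leRHS]EFinM.
by rewrite lee_wpmul2l ?lee_fin ?bin_weight_ge0.
Qed.

Lemma cell_volume N n (A : set (n.-tuple R)) (P : seq nat -> bool) :
  A `<=` cell_union N P ->
  (volume A <= (binomial_mean N n (fun s => (P s)%:R))%:E)%E.
Proof.
move=> AP; have [mC C] := cell_union_measure N n P.
apply: le_trans C; have [_ <-] := lebesgue_measurable_borel mC.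
exact: le_outer_measure.
Qed.

End cells.

(** * Distance between sets of equal volume *)

Section upper_bound.
Context {R : realType}.

Lemma max_weight_small (e : R) : 0 < e -> exists2 m, (0 < m)%N & max_weight m <= e.
Proof.
move=> e0; have e20 : 0 < e ^+ 2 by rewrite exprn_gt0.
exists (Num.truncn (e ^+ 2)^-1).+1 => //; set m := (_.+1)%N.
rewrite -(@ler_pXn2r _ 2%N) ?nnegrE ?max_weight_ge0 ?(ltW e0) //.
apply: le_trans (@central_bin_le R m _) _ => //.
have m1 : (e ^+ 2)^-1 <= m%:R by rewrite ltW // truncnS_gt.
have m0 : 0 < m%:R :> R by rewrite ltr0n.
rewrite -[leRHS]invrK lef_pV2 ?posrE ?invr_gt0 ?mulr_gt0 ?pi_gt0 //.
apply: le_trans m1 _; rewrite ler_peMl ?(ltW m0) //.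
by apply: le_trans (pi_ge2 R); rewrite ler1n.
Qed.

(** One point of A in each cell of a fine partition that meets A; the cells that miss A
    receive an arbitrary point of A. *)
Lemma fine_net n (A : set (n.-tuple R)) (w : R) : A !=set0 -> A `<=` @unit_cube R n ->
  0 < w -> exists (I : finType) (P : I -> n.-tuple R), [/\ (0 < #|I|)%N,
    forall q, A (P q) &
    forall x, A x -> exists q, forall i, `|tnth x i - tnth (P q) i| <= w].
Proof.
move=> [a0 Aa0] Acube w0; have [m m0 mw] := max_weight_small w0.
pose C (t : n.-tuple 'I_m.*2.+1) : set (n.-tuple R) :=
  [set x | A x /\ in_cell m.*2 [seq val k | k <- t] x].
exists (n.-tuple 'I_m.*2.+1 : finType), (fun t => xget a0 (C t)); split.
- by rewrite card_tuple expn_gt0 card_ord.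
- by move=> t; case: xgetP => [y _ []|].
move=> x Ax; have [t ct] := cell_exists m.*2 (Acube _ Ax).
exists t => i; case: xgetP => [y _ [Ay cy]|/(_ x)/not_andP[]//].
apply: le_trans mw; apply: le_trans (bin_weight_le m (nth 0%N [seq val k | k <- t] i)).
move: ct cy => [_ _ /(_ i)/andP[x1 x2]] [_ _ /(_ i)/andP[y1 y2]].
rewrite -/(grid m.*2 _ _) in x1 x2 y1 y2.
move: x1 x2 y1 y2; rewrite /grid grid_pointS => x1 x2 y1 y2.
by rewrite ler_norml; apply/andP; split; lra.
Qed.

Let ratio_ge (lambda tau : R) : 0 < tau -> tau^-1 <= lambda ->
  1 - tau <= lambda / Num.sqrt (1 + lambda ^+ 2).
Proof.
move=> tau0 lt; have l0 : 0 < lambda by apply: lt_le_trans lt; rewrite invr_gt0.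
have s0 : 0 < Num.sqrt (1 + lambda ^+ 2) by rewrite sqrtr_gt0 ltr_pwDl // sqr_ge0.
have s1 : Num.sqrt (1 + lambda ^+ 2) <= 1 + lambda.
  rewrite -[leRHS]ger0_norm ?addr_ge0 ?(ltW l0) // -sqrtr_sqr ler_wsqrtr //.
  by rewrite sqrrD expr1n mul1r addrAC lerDl mulrn_wge0 // ltW.
have tl : 1 <= tau * lambda by rewrite mulrC -ler_pdivrMr // mul1r.
rewrite ler_pdivlMr //.
have [t1|t1] := leP 1 tau.
  by apply: (@le_trans _ _ 0); [rewrite mulr_le0_ge0 ?subr_le0 // ltW|exact: ltW].
apply: (@le_trans _ _ ((1 - tau) * (1 + lambda))).
  by rewrite ler_wpM2l // subr_ge0 ltW.
lra.
Qed.

Let soft_norm_bounds n (I : finType) (p : I -> n.-tuple R) (delta : R) (x : nat -> R) q :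
  0 < delta ->
  enorm (fun i : 'I_n => x i - tnth (p q) i) <=
    soft_norm n (fun q i => nth 0 (p q) i) delta x q <=
  delta + enorm (fun i : 'I_n => x i - tnth (p q) i).
Proof.
move=> d0; rewrite /enorm /soft_norm.
have -> : \sum_(i < n) (x i - nth 0 (p q) i) ^+ 2 =
    \sum_(i < n) (x i - tnth (p q) i) ^+ 2.
  by apply: eq_bigr => i _; rewrite (tnth_nth 0).
set S := \sum_(i < n) _.
have S0 : 0 <= S by apply: sumr_ge0 => i _; exact: sqr_ge0.
rewrite ler_wsqrtr ?lerDr ?sqr_ge0 //=.
rewrite -[leRHS]ger0_norm ?addr_ge0 ?sqrtr_ge0 ?(ltW d0) // -sqrtr_sqr ler_wsqrtr //.
by rewrite sqrrD sqr_sqrtr // addrAC lerDl mulrn_wge0 // mulr_ge0 ?sqrtr_ge0 // ltW.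
Qed.

(** If d exceeded - 2 Phi_inv eps, then 2 theta would fit strictly between, with
    Phi (- theta) < eps. The gap pays for all the errors: sigma bounds the smoothing,
    the net, the soft minimum and the mesh, and tau the relative loss in the slope. *)
Lemma separated_sets_le n (A B : set (n.-tuple R)) (eps d : R) :
  0 < eps < 1 / 2 -> A `<=` @unit_cube R n -> B `<=` @unit_cube R n ->
  volume A = eps%:E -> volume B = eps%:E ->
  (forall x y, A x -> B y -> d <= euclidean_dist x y) ->
  d <= - 2 * Phi_inv eps.
Proof.
move=> eps12 Ac Bc vA vB AB; have /andP[eps0 epsh] := eps12.
have eps01 : 0 < eps < 1 by rewrite eps0; lra.
rewrite leNgt; apply/negP => dgt.
pose theta0 := - Phi_inv eps.
have theta00 : 0 <= theta0.
  by rewrite oppr_ge0 -[leRHS]Phi_inv_half Phi_inv_le //; lra.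
pose theta := (theta0 + d / 2) / 2.
have td : theta0 < theta /\ 2 * theta < d by rewrite /theta; rewrite /theta0 in theta00 *; lra.
have [t0 t1] := td.
have Pt : Phi (- theta) < eps.
  rewrite -[ltRHS]Phi_invK // (leW_mono Phi_mono) -[ltRHS]opprK ltrN2 //.
have [Y PY] : exists Y, Phi Y = Phi (- theta) / eps.
  by apply: Phi_onto; rewrite divr_gt0 ?Phi_gt0 //= ltr_pdivrMr // mul1r.
have d0 : 0 < d by lra.
pose gap := d - 2 * theta; have gap0 : 0 < gap by rewrite /gap; lra.
(* the distances lose 7 sigma < gap / 2 in total, the slopes 2 tau d = gap / 4 *)
pose sigma := gap / 16; have sigma0 : 0 < sigma by rewrite divr_gt0.
pose tau := gap / (8 * d); have tau0 : 0 < tau by rewrite divr_gt0 // mulr_gt0.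
(* lambda is large enough for the slope, lambda / sqrt (1 + lambda^2) >= 1 - tau, and
   for eps * Phi (lambda * sigma) >= Phi (- theta) *)
pose lambda := tau^-1 + `|Y| / sigma.
have lt : tau^-1 <= lambda by rewrite lerDl divr_ge0 // ltW.
have lambda0 : 0 < lambda by apply: lt_le_trans lt; rewrite invr_gt0.
have lY : Y <= lambda * sigma.
  rewrite mulrDl divfK ?gt_eqF //; apply: le_trans (ler_norm Y) _.
  by rewrite lerDr mulr_ge0 ?invr_ge0 ?(ltW tau0) ?(ltW sigma0).
have Ane : A !=set0.
  apply/set0P/eqP => A0; move: vA; rewrite A0 /volume.
  have [_ ] := @lebesgue_measurable_borel R n set0 measurable0.
  rewrite /volume => ->; rewrite measure0 => -[/esym] e0.
  by move: eps0; rewrite e0 ltxx.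
pose rn : R := Num.sqrt n%:R.
have rn0 : 0 <= rn by exact: sqrtr_ge0.
pose w := sigma / (1 + rn).
have rn1 : 0 < 1 + rn by rewrite ltr_pwDl.
have w0 : 0 < w by rewrite divr_gt0.
have rnw : rn * w <= sigma.
  rewrite /w mulrA ler_pdivrMr // mulrC ler_wpM2l ?(ltW sigma0) // lerDr //.
have [I [p [I0 Ap net]]] := fine_net Ane Ac w0.
pose P q i : R := nth 0 (p q) i.
pose beta := ln #|I|%:R / sigma + 1.
have lnI : 0 <= ln #|I|%:R :> R by rewrite ln_ge0 // ler1n.
have beta0 : 0 < beta by rewrite ltr_wpDl // divr_ge0 // ltW.
have lnb : ln #|I|%:R / beta <= sigma.
  rewrite ler_pdivrMr // mulrDr mulr1 mulrCA mulfV ?gt_eqF // mulr1 lerDl.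
  exact: ltW.
have [L [v0 [L0 v00 iso]]] :=
  soft_indicator_isoperimetry n P sigma0 beta0 lambda0 I0.
(* below e1 the error term sqrt (L w) is at most tau * phi theta *)
pose e1 := (tau * phi theta) ^+ 2 / (1 + L).
have e10 : 0 < e1.
  by apply: divr_gt0; [apply: exprn_gt0; rewrite mulr_gt0 ?phi_gt0|rewrite ltr_pwDl].
have [m m0 mw] := @max_weight_small (Num.min v0 (Num.min w e1))
  ltac:(by rewrite !lt_min v00 w0).
move: mw; rewrite !le_min => /and3P[mv mw me].
pose eta := Num.sqrt (L * max_weight m).
have eta0 : 0 <= eta by exact: sqrtr_ge0.
have eta1 : eta / phi theta <= tau.
  have tp : 0 <= tau * phi theta.
    by apply: mulr_ge0; [exact: ltW|exact/ltW/phi_gt0].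
  rewrite ler_pdivrMr ?phi_gt0 // -[leRHS](ger0_norm tp).
  rewrite -sqrtr_sqr ler_wsqrtr //.
  apply: (@le_trans _ _ ((1 + L) * max_weight m)).
    by rewrite ler_wpM2r ?max_weight_ge0 // lerDr.
  by rewrite mulrC -ler_pdivlMr // ltr_pwDl.
pose N := m.*2.
pose cells (S : set (n.-tuple R)) s := `[< exists2 x, S x & in_cell N s x >].
have cells_vol S : S `<=` @unit_cube R n -> volume S = eps%:E ->
    eps <= binomial_mean N n (fun s => (cells S s)%:R).
  move=> Sc vS; rewrite -lee_fin -vS; apply: cell_volume => x Sx.
  have [t ct] := cell_exists N (Sc _ Sx).
  by exists [seq val k | k <- t] => //; apply/asboolP; exists x.
have close s x : in_cell N s x -> enorm (fun i : 'I_n => grid N s i - tnth x i) <= sigma.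
  move=> cx; apply: le_trans rnw; apply: enorm_le; first exact: ltW.
  move=> i; rewrite distrC; apply: le_trans (in_cell_close i cx) _.
  exact: le_trans (bin_weight_le _ _) mw.
have triangle (f g h : 'I_n -> R) :
    enorm (fun i => f i - h i) <= enorm (fun i => f i - g i) + enorm (fun i => g i - h i).
  have -> : (fun i => f i - h i) = (fun i => (f i - g i) + (g i - h i)).
    by apply/funext => i; ring.
  exact: enorm_triangle.
have enormC (f g : 'I_n -> R) : enorm (fun i => f i - g i) = enorm (fun i => g i - f i).
  by congr Num.sqrt; apply: eq_bigr => i _; rewrite -sqrrN opprB.
have rhoA s : cells A s -> soft_dist n P sigma beta (grid N s) <= 3 * sigma.
  move=> /asboolP[x Ax cx]; have [q hq] := net x Ax.
  apply: le_trans (soft_dist_le _ _ _ beta0 I0 _ q) _.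
  have /andP[_ h] := @soft_norm_bounds n I p sigma (grid N s) q sigma0.
  apply: le_trans h _.
  have := triangle (grid N s) (fun i => tnth x i) (fun i => tnth (p q) i).
  have := close s x cx.
  have : enorm (fun i : 'I_n => tnth x i - tnth (p q) i) <= sigma.
    by apply: le_trans rnw; apply: enorm_le => //; exact: ltW.
  lra.
have rhoB s : cells B s -> d - 2 * sigma <= soft_dist n P sigma beta (grid N s).
  move=> /asboolP[y By cy].
  have : d - sigma - ln #|I|%:R / beta <= soft_dist n P sigma beta (grid N s).
    apply: soft_dist_ge => // q.
    have /andP[h _] := @soft_norm_bounds n I p sigma (grid N s) q sigma0.
    apply: le_trans h.
    have := triangle (fun i => tnth y i) (grid N s) (fun i => tnth (p q) i).
    rewrite (enormC (fun i => tnth y i) (grid N s)).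
    have := close s y cy.
    have := AB _ _ (Ap q) By.
    rewrite /euclidean_dist -/(enorm (fun i => tnth (p q) i - tnth y i)).
    rewrite (enormC (fun i => tnth (p q) i)).
    lra.
  lra.
have := @two_sets_growth R I n P sigma beta lambda m eta lambda0 eta0
  (fun c => iso m c m0 mv) (cells A) (cells B) eps theta (3 * sigma)
  (d - 2 * sigma) sigma (cells_vol A Ac vA) (cells_vol B Bc vB) _ rhoA rhoB.
have hY : Phi (- theta) <= eps * Phi (lambda * sigma).
  rewrite -[leLHS](divfK (lt0r_neq0 eps0)) mulrC -PY ler_wpM2l ?(ltW eps0) //.
  by rewrite Phi_mono.
move=> /(_ hY).
have dg : d = gap + 2 * theta by rewrite /gap; ring.
have sg : gap = 16 * sigma by rewrite /sigma; field.
have th0 : 0 <= theta by lra.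
have c1 : 3 * sigma + sigma <= d - 2 * sigma - sigma by lra.
move=> /(_ c1); apply/negP; rewrite -ltNge.
have k := ratio_ge tau0 lt; set kappa := lambda / _ in k *.
have td8 : tau * d = gap / 8.
  by rewrite /tau; field; rewrite gt_eqF.
have tau1 : tau < 1.
  by rewrite /tau ltr_pdivrMr ?mulr_gt0 // mul1r; lra.
have rw : d - 2 * sigma - 3 * sigma - 2 * sigma = d - 7 * sigma by ring.
rewrite rw.
have p1 : 0 < d - 7 * sigma by lra.
apply: (@lt_le_trans _ _ ((1 - tau) * (1 - tau) * (d - 7 * sigma))).
  have : tau * tau * (d - 7 * sigma) >= 0 by apply: mulr_ge0; [apply: mulr_ge0|]; exact: ltW.
  have : 0 <= tau * sigma by apply: mulr_ge0; exact: ltW.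
  nra.
have t1' : 0 <= 1 - tau by rewrite subr_ge0 ltW.
by apply: ler_wpM2r; [exact: ltW|apply: ler_pM => //; rewrite lerD2l lerN2].
Qed.

End upper_bound.

(** * One uniform variable against the heat flow *)

Section taylor.
Context {R : realType}.
Implicit Types (f df : R -> R) (a b x y z s t : R).

Lemma taylor2 f df ddf a b K :
  (forall x, a <= x <= b \/ b <= x <= a -> is_derive x 1 f (df x)) ->
  (forall x, a <= x <= b \/ b <= x <= a -> is_derive x 1 df (ddf x)) ->
  (forall x, a <= x <= b \/ b <= x <= a -> `|ddf x| <= K) ->
  `|f b - f a - df a * (b - a)| <= K * (b - a) ^+ 2.
Proof.
move=> d dd hK; have [c cab ->] := MVT_between d.
rewrite -mulrBl normrM -(real_normK (num_real (b - a))) expr2 mulrA.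
apply: ler_wpM2r => //.
have sub x : a <= x <= c \/ c <= x <= a -> a <= x <= b \/ b <= x <= a.
  by case: cab => /andP[? ?] [] /andP[? ?]; [left|left|right|right]; lra.
have [e eac ->] := @MVT_between R df ddf a c (fun x h => dd x (sub x h)).
rewrite normrM; apply: ler_pM => //; first exact/hK/sub.
exact: between_abs.
Qed.

Lemma taylor3 f df ddf dddf a b K :
  (forall x, is_derive x 1 f (df x)) -> (forall x, is_derive x 1 df (ddf x)) ->
  (forall x, is_derive x 1 ddf (dddf x)) -> (forall x, `|dddf x| <= K) ->
  `|f b - f a - df a * (b - a) - ddf a * (b - a) ^+ 2 / 2| <= K * `|b - a| ^+ 3.
Proof.
move=> d dd ddd hK.
pose g x := f x - f a - df a * (x - a) - ddf a * (x - a) ^+ 2 / 2.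
have ga : g a = 0 by rewrite /g !subrr; ring.
have dg x : a <= x <= b \/ b <= x <= a ->
    is_derive x 1 g (df x - df a - ddf a * (x - a)).
  by move=> _; have dx := d x; apply: is_derive_eq; rewrite /GRing.scale /=; field.
have [c cab] := MVT_between dg; rewrite ga subr0 -/(g b) => ->.
rewrite normrM [_ ^+ 3]exprSr mulrA ler_wpM2r //.
apply: (le_trans (taylor2 (ddf := dddf) (fun x _ => dd x) (fun x _ => ddd x) (fun x _ => hK x))).
have K0 : 0 <= K by apply: le_trans (hK a); exact: normr_ge0.
rewrite ler_wpM2l // -(real_normK (num_real (c - a))) lerXn2r ?nnegrE //.
exact: between_abs.
Qed.

End taylor.

Section heat_step.
Context {R : realType}.
Implicit Types (a r s u x y z : R).

Let dphi x : R := - (2 * pi * x) * phi x.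

Let is_derive_dphi x :
  is_derive x 1 dphi ((4 * pi ^+ 2 * x ^+ 2 - 2 * pi) * phi x).
Proof.
rewrite /dphi; have h := is_derive_phi x; apply: is_derive_eq.
by rewrite /GRing.scale /=; ring.
Qed.

Let ddphi_le x : `|(4 * pi ^+ 2 * x ^+ 2 - 2 * pi) * phi x| <= 6 * pi.
Proof.
have pi0 := pi_gt0 R.
rewrite normrM (gtr0_norm (phi_gt0 x)).
have x2 : 0 <= pi * x ^+ 2 by rewrite mulr_ge0 ?sqr_ge0 // ltW.
apply: (@le_trans _ _ ((6 * pi * (1 + pi * x ^+ 2)) * phi x)).
  rewrite ler_wpM2r ?(ltW (phi_gt0 x)) //.
  apply: le_trans (ler_normB _ _) _.
  rewrite ger0_norm ?ger0_norm; [|by rewrite mulr_ge0 // ltW|].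
    by move: (x ^+ 2) x2 => X x2; nra.
  by rewrite mulr_ge0 ?sqr_ge0 // mulr_ge0 // sqr_ge0.
rewrite -mulrA ler_piMr ?mulr_ge0 ?(ltW pi0) // /phi expRN ler_pdivrMr ?expR_gt0 // mul1r.
exact: expR_ge1Dx.
Qed.

Let Phi_taylor z y : `|Phi y - Phi z - phi z * (y - z) - dphi z * (y - z) ^+ 2 / 2| <=
  6 * pi * `|y - z| ^+ 3.
Proof.
exact: (@taylor3 R Phi phi dphi (fun x => (4 * pi ^+ 2 * x ^+ 2 - 2 * pi) * phi x)
  z y _ is_derive_Phi is_derive_phi is_derive_dphi ddphi_le).
Qed.

(** A bound on the second derivative of r |-> Phi (r z): since r^2 >= 1 / 2, the
    exponential exp (- pi z^2 / 2) dominates the cube of z. *)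
Let cube_phi_le r z : 2^-1 <= r ^+ 2 -> r ^+ 2 <= 1 -> `|2 * pi * r * z ^+ 3 * phi (r * z)| <= 6 * pi.
Proof.
move=> r1 r2; have pi0 := pi_gt0 R; have pi2 := pi_ge2 R.
have ra : `|r| <= 1 by rewrite -(@expr_le1 _ 2) // real_normK ?num_real.
rewrite 4!normrM (gtr0_norm (phi_gt0 _)) (gtr0_norm pi0) (ger0_norm (ler0n R 2)) normrX.
have h : `|z| ^+ 3 * phi (r * z) <= 3.
  pose y := pi * z ^+ 2 / 2.
  have z20 := sqr_ge0 z.
  have y0 : 0 <= y by rewrite /y divr_ge0 // mulr_ge0 // ltW.
  have e2 := @expR_ge1Dxn R y 1 y0.
  have ey : phi (r * z) <= expR (- y).
    rewrite /phi ler_expR lerN2 /y exprMn.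
    by rewrite -mulrA ler_pM2l // mulrC ler_wpM2r.
  apply: (@le_trans _ _ (`|z| ^+ 3 * expR (- y))).
    by rewrite ler_wpM2l // exprn_ge0.
  rewrite expRN ler_pdivrMr ?expR_gt0 //.
  have z3 : `|z| ^+ 3 <= 1 + `|z| ^+ 4.
    have := normr_ge0 z; move: `|z| => Z Z0; case: (leP Z 1) => Z1.
      by rewrite -[leLHS]addr0 lerD ?exprn_ge0 // exprn_ile1.
    by rewrite [_ ^+ 4]exprS -[leLHS]add0r lerD // ler_peMl ?exprn_ge0 // ltW.
  have z4 : `|z| ^+ 4 = z ^+ 4.
    by rewrite -[4%N]/(2 * 2)%N !exprM real_normK ?num_real.
  have y4 : z ^+ 4 <= y ^+ 2.
    have -> : y ^+ 2 = z ^+ 4 * (pi / 2) ^+ 2 by rewrite /y; field.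
    rewrite ler_peMr //; first by rewrite -z4 exprn_ge0.
    by rewrite exprn_ege1 // pihalf_ge1.
  have f2 : (2`!)%:R = 2 :> R by [].
  rewrite f2 in e2; have y20 := sqr_ge0 y; have e1 : 1 <= expR y by rewrite -expR0 ler_expR.
  lra.
rewrite -[leLHS]mulrA.
have -> : 6 * pi = 2 * pi * 1 * 3 :> R by ring.
apply: ler_pM => //.
- by rewrite !mulr_ge0 // ltW.
- by rewrite mulr_ge0 ?exprn_ge0 // ltW ?phi_gt0.
- by rewrite ler_wpM2l // mulr_ge0 // ltW.
Qed.

Let Phi_dilation r z : 0 < r -> 2^-1 <= r ^+ 2 -> r <= 1 ->
  `|Phi (r * z) - Phi z - z * phi z * (r - 1)| <= 6 * pi * (r - 1) ^+ 2.
Proof.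
move=> r0 r12 r1.
have c1 (t : R) : is_derive t 1 (fun t => t * z) z.
  by apply: is_derive_eq; rewrite /GRing.scale /=; ring.
have d (t : R) : is_derive t 1 (fun t => Phi (t * z)) (z * phi (t * z)).
  rewrite mulrC; exact: (@is_derive1_comp R Phi (fun t => t * z) t _ _ (is_derive_Phi _) (c1 t)).
have dd (t : R) : is_derive t 1 (fun t => z * phi (t * z)) (- (2 * pi * t * z ^+ 3 * phi (t * z))).
  have h : is_derive t 1 (fun t => phi (t * z)) (- (2 * pi * (t * z)) * phi (t * z) * z).
    exact: (@is_derive1_comp R phi (fun t => t * z) t _ _ (is_derive_phi _) (c1 t)).
  by apply: is_derive_eq; rewrite /GRing.scale /=; ring.
have := @taylor2 R (fun t => Phi (t * z)) (fun t => z * phi (t * z)) _ 1 r (6 * pi)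
  (fun t _ => d t) (fun t _ => dd t).
rewrite !mul1r; apply => t h; rewrite normrN; apply: cube_phi_le.
  by apply: le_trans r12 _; rewrite lerXn2r ?nnegrE //; lra.
by rewrite expr_le1 //; lra.
Qed.

(** (t, a) |-> Phi (a / sqrt t) solves the heat equation d/dt = 1 / (4 pi) d^2/da^2.
    The right-hand side is the second-order expansion of the mean of Phi after one
    uniform variable, of variance 1 / 12; it matches the flow during the time
    4 pi / 24 = pi / 6. *)
Lemma Phi_heat_step a s : 1 <= s ->
  Phi (a / Num.sqrt (s ^+ 2 + pi / 6)) - 20 / s ^+ 3 <=
  Phi (a / s) + dphi (a / s) / (24 * s ^+ 2) - 3 / 4 * pi / s ^+ 3.
Proof.
move=> s1; have s0 : 0 < s by lra.
have pi0 := pi_gt0 R; have pi4 := @pihalf_lt2 R.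
set S := Num.sqrt _; pose e : R := pi / (6 * s ^+ 2).
have s20 : 0 < s ^+ 2 by rewrite exprn_gt0.
have s21 : 1 <= s ^+ 2 by rewrite exprn_ege1.
have S2 : S ^+ 2 = s ^+ 2 * (1 + e).
  rewrite sqr_sqrtr; last by rewrite addr_ge0 ?divr_ge0 ?(ltW s20) ?(ltW pi0).
  by rewrite /e; move: (pi : R) => p; field; rewrite gt_eqF.
have e0 : 0 < e by rewrite divr_gt0 // mulr_gt0.
have e1 : e <= 2 / 3 / s ^+ 2.
  rewrite /e invfM mulrA ler_wpM2r ?invr_ge0 ?(ltW s20) //; lra.
have e3 : e <= 1.
  apply: (le_trans e1); rewrite ler_pdivrMr // mul1r; lra.
have S0 : 0 < S by rewrite sqrtr_gt0 addr_gt0 // divr_gt0.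
pose r := s / S.
have r0 : 0 < r by rewrite divr_gt0.
have r2 : r ^+ 2 * (1 + e) = 1.
  rewrite expr_div_n S2; field.
  by rewrite !gt_eqF //; lra.
have r1 : r <= 1 by rewrite -(@expr_le1 _ 2) ?(ltW r0) //; nra.
have r12 : 2^-1 <= r ^+ 2 by nra.
pose z := a / s.
have -> : a / S = r * z by rewrite /r /z; field; rewrite !gt_eqF.
have /ler_normlP[_ T] := Phi_dilation z r0 r12 r1.
rewrite -/z.
have zphi : `|z * phi z| <= 1.
  have p0 : 0 < 2 * pi :> R by rewrite mulr_gt0.
  have := is_derive_phi_le z.
  have -> : - (2 * pi * z) * phi z = - (2 * pi * (z * phi z)) by ring.
  by rewrite normrN normrM (gtr0_norm p0) ger_pMr.
pose d := 1 - r; have d0 : 0 <= d by rewrite subr_ge0.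
have q : 1 - r ^+ 2 = e * r ^+ 2 by lra.
have D : (e / 2 - d) * (2 * (1 + r)) = e * d * (1 + 2 * r).
  have -> : (e / 2 - d) * (2 * (1 + r)) = e * (1 + r) - 2 * (1 - r ^+ 2) by rewrite /d; field.
  by rewrite q /d; ring.
have de : d <= e.
  have h : d * (1 + r) = e * r ^+ 2 by rewrite -q /d; ring.
  have : e * r ^+ 2 <= e * 1 by rewrite ler_wpM2l ?(ltW e0) // expr_le1 // ltW.
  have := mulr_ge0 d0 (ltW r0); rewrite -h; lra.
have d1 : 0 <= e / 2 - d.
  rewrite -(pmulr_lge0 _ (x := 2 * (1 + r))); last by rewrite mulr_gt0 // addr_gt0.
  by rewrite D; apply: mulr_ge0; [apply: mulr_ge0 => //; exact: ltW|lra].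
have d2 : e / 2 - d <= e ^+ 2.
  apply: (@le_trans _ _ (e * d)); last by rewrite expr2 ler_wpM2l // ltW.
  rewrite -subr_ge0 -(pmulr_lge0 _ (x := 2 * (1 + r))); last by rewrite mulr_gt0 // addr_gt0.
  rewrite mulrBl D -subr_ge0 subr0 -mulrBr.
  by apply: mulr_ge0; [apply: mulr_ge0 => //; exact: ltW|lra].
have T1 : z * phi z * (r - 1) <= - (e / 2) * (z * phi z) + e ^+ 2.
  have -> : z * phi z * (r - 1) = - (e / 2) * (z * phi z) + z * phi z * (e / 2 - d).
    by rewrite /d; ring.
  rewrite lerD2l; apply: le_trans (ler_norm _) _; rewrite normrM (ger0_norm d1).
  by apply: le_trans d2; rewrite ler_piMl.
have T2 : (r - 1) ^+ 2 <= e ^+ 2.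
  by rewrite -sqrrN opprB lerXn2r ?nnegrE // ltW.
have -> : dphi z / (24 * s ^+ 2) = - (e / 2) * (z * phi z).
  by rewrite /dphi /e; move: (pi : R) => p; field; rewrite gt_eqF.
have e4 : e ^+ 2 <= 4 / 9 / s ^+ 3.
  apply: (@le_trans _ _ ((2 / 3 / s ^+ 2) ^+ 2)).
    by rewrite lerXn2r ?nnegrE ?(ltW e0) // divr_ge0 // ltW.
  have -> : (2 / 3 / s ^+ 2) ^+ 2 = 4 / 9 / s ^+ 3 / s :> R.
    by field; rewrite gt_eqF.
  by rewrite ler_pdivrMr // ler_peMr // divr_ge0 // exprn_ge0 // ltW.
have s3 : 0 < s ^- 3 by rewrite invr_gt0 exprn_gt0.
have p4 : pi <= 4 :> R by lra.
have T3 : 6 * pi * (r - 1) ^+ 2 <= 24 * e ^+ 2.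
  by apply: ler_pM => //; rewrite ?sqr_ge0 //; lra.
have p3 : pi * s ^- 3 <= 4 * s ^- 3 by rewrite ler_wpM2r // ltW.
move: T T1 T3 e4 p3 s3; rewrite -!mulrA; move: (e ^+ 2) (s ^- 3) => E2 S3.
lra.
Qed.

(** The odd terms of the Taylor expansion integrate to zero. *)
Lemma uniform_step sg a s : sg ^+ 2 = 1 -> 1 <= s ->
  Phi (a / Num.sqrt (s ^+ 2 + pi / 6)) - 20 / s ^+ 3 <=
  \int[lebesgue_measure]_(u in `[0, 1]) Phi ((a - sg * (u - 1 / 2)) / s).
Proof.
move=> sg2 s1; have s0 : 0 < s by lra.
have pi0 := pi_gt0 R.
pose z := a / s; pose B : R := 3 / 4 * pi / s ^+ 3.
pose P u := Phi z - phi z * sg / s * (u - 1 / 2) +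
  dphi z / (2 * s ^+ 2) * (u - 1 / 2) ^+ 2 - B.
pose F u := Phi z * u - phi z * sg / s * (u - 1 / 2) ^+ 2 / 2 +
  dphi z / (2 * s ^+ 2) * (u - 1 / 2) ^+ 3 / 3 - B * u.
have derF (c1 c2 c3 c4 u : R) : is_derive u 1
    (fun u => c1 * u - c2 * (u - 1 / 2) ^+ 2 / 2 + c3 * (u - 1 / 2) ^+ 3 / 3 - c4 * u)
    (c1 - c2 * (u - 1 / 2) + c3 * (u - 1 / 2) ^+ 2 - c4).
  have h : is_derive u 1 (fun u : R => (u - 1 / 2) ^+ 3) (3 * (u - 1 / 2) ^+ 2).
    by apply: is_derive_eq; rewrite /GRing.scale /=; field.
  by apply: is_derive_eq; rewrite /GRing.scale /=; field.
have derP (c1 c2 c3 c4 u : R) : is_derive u 1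
    (fun u => c1 - c2 * (u - 1 / 2) + c3 * (u - 1 / 2) ^+ 2 - c4)
    (- c2 + c3 * (2 * (u - 1 / 2))).
  by apply: is_derive_eq; rewrite /GRing.scale /=; field.
have dF (u : R) : is_derive u 1 F (P u) by exact: derF.
have dP : continuous P by move=> u; exact: is_derive_continuous (derP _ _ _ _ u).
have cG : continuous (fun u => Phi ((a - sg * (u - 1 / 2)) / s)).
  move=> u; apply: (@continuous_comp _ _ _ (fun u : R => (a - sg * (u - 1 / 2)) / s) Phi).
    have h : is_derive u 1 (fun u : R => (a - sg * (u - 1 / 2)) / s) (- sg / s).
      by apply: is_derive_eq; rewrite /GRing.scale /=; field; rewrite gt_eqF.
    exact: is_derive_continuous h.
  exact: continuous_Phi.
apply: (@le_trans _ _ (\int[lebesgue_measure]_(u in `[0, 1]) P u)).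
  rewrite (Rintegral_FTC ltr01 dP dF).
  have -> : F 1 - F 0 = Phi z + dphi z / (24 * s ^+ 2) - B.
    rewrite /F; field; rewrite gt_eqF //.
  exact: Phi_heat_step.
apply: le_Rintegral; [by []|exact: continuous_integrable_segment
                     |exact: continuous_integrable_segment|move=> u].
rewrite /= in_itv /= => /andP[u0 u1].
have := Phi_taylor z ((a - sg * (u - 1 / 2)) / s).
have -> : (a - sg * (u - 1 / 2)) / s - z = - (sg * (u - 1 / 2) / s).
  by rewrite /z; field; rewrite gt_eqF.
rewrite sqrrN normrN => /ler_normlP[T _].
have T1 : `|sg * (u - 1 / 2) / s| ^+ 3 <= 1 / 8 / s ^+ 3.
  rewrite normrM normfV (gtr0_norm s0) normrM.
  have -> : `|sg| = 1 by apply/eqP; rewrite -(@eqrXn2 _ 2) // expr1n real_normK ?num_real ?sg2.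
  rewrite [1 * `|_|]mul1r expr_div_n ler_pM2r ?invr_gt0 ?exprn_gt0 //.
  have -> : 1 / 8 = (1 / 2) ^+ 3 :> R by field.
  have hu : `|u - 1 / 2| <= 1 / 2 by rewrite ler_norml; lra.
  by rewrite lerXn2r ?nnegrE ?divr_ge0.
have T2 : 6 * pi * `|sg * (u - 1 / 2) / s| ^+ 3 <= B.
  have -> : B = 6 * pi * (1 / 8 / s ^+ 3).
    by rewrite /B; move: (pi : R) => p; field; rewrite gt_eqF.
  by rewrite ler_pM2l ?mulr_gt0.
have e2 : (sg * (u - 1 / 2) / s) ^+ 2 = (u - 1 / 2) ^+ 2 / s ^+ 2.
  by rewrite expr_div_n exprMn sg2 [1 * (_ ^+ _)]mul1r.
rewrite e2 in T.
rewrite /P.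
have -> : dphi z / (2 * s ^+ 2) * (u - 1 / 2) ^+ 2 = dphi z * ((u - 1 / 2) ^+ 2 / s ^+ 2) / 2.
  by move: (dphi z) => c; field; rewrite gt_eqF.
have -> : phi z * sg / s * (u - 1 / 2) = phi z * (sg * (u - 1 / 2) / s) by ring.
rewrite mulrN in T; move: T T2; move: (phi z * _) (dphi z * _) => X Y.
lra.
Qed.

End heat_step.

(** * Volume of half-cubes *)

Section half_cube.
Context {R : realType}.

(** The sign sg = 1 or -1 selects one of two opposite half-cubes, mirror images of each
    other. *)
Definition half_cube (sg : R) k (a : R) : set (k.-tuple R) :=
  [set x | unit_cube x /\ \sum_(i < k) sg * (tnth x i - 1 / 2) <= a].

Lemma measurable_unit_cube k : measurable (@unit_cube R k).
Proof.
have -> : @unit_cube R k = \bigcap_(i in [set: 'I_k])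
    ((fun x : k.-tuple R => tnth x i) @^-1` [set` `]0, 1[]).
  apply/seteqP; split => x /= h i; first by move=> _; rewrite /= in_itv /=; exact: h.
  by have := h i I; rewrite /= in_itv.
apply: fin_bigcap_measurable => // i _.
by rewrite -[X in measurable X]setTI; apply: measurable_tnth.
Qed.

Lemma measurable_half_cube sg k a : measurable (@half_cube sg k a).
Proof.
pose f (x : k.-tuple R) : R := \sum_(i < k) sg * (tnth x i - 1 / 2).
have mf : measurable_fun setT f.
  apply: measurable_sum => i; apply: measurable_funM => //.
  apply: measurable_funB => //; exact: measurable_tnth.
have -> : @half_cube sg k a = @unit_cube R k `&` (setT `&` f @^-1` `]-oo, a]).
  apply/seteqP; split => x; rewrite /half_cube /preimage /= in_itv /=.
    by move=> [].
  by move=> [? []].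
apply: measurableI; first exact: measurable_unit_cube.
exact: mf.
Qed.

Let section_measure sg k a (u : R) : \bar R :=
  lebesgue_prod (xsection (@tuple_cons R k @^-1` half_cube sg a) u).

Let half_cube_measureS sg k a : lebesgue_prod (@half_cube sg k.+1 a) =
  (\int[lebesgue_measure]_u section_measure sg k a u)%E.
Proof. by []. Qed.

Let section_measureE sg k a u : 0 < u < 1 ->
  section_measure sg k a u = lebesgue_prod (@half_cube sg k (a - sg * (u - 1 / 2))).
Proof.
move=> u01; congr lebesgue_prod; apply/seteqP; split => t; rewrite /xsection /= inE /half_cube /=.
  move=> [h1]; rewrite big_ord_recl /= => h2; split.
    by move=> i; have := h1 (lift ord0 i); rewrite tnthS.
  rewrite lerBrDl; apply: le_trans h2; rewrite lerD2l le_eqVlt; apply/orP; left; apply/eqP.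
  by apply: eq_bigr => i _; rewrite tnthS.
move=> [h1 h2]; split.
  by move=> i; have [j ->|->] := unliftP ord0 i; [rewrite tnthS; exact: h1|].
rewrite big_ord_recl /= -lerBrDl; apply: le_trans h2; rewrite le_eqVlt; apply/orP; left; apply/eqP.
by apply: eq_bigr => i _; rewrite tnthS.
Qed.

Let measurable_section sg k a : measurable_fun setT (section_measure sg k a).
Proof.
apply: measurable_fun_xsection.
rewrite -[X in measurable X]setTI; apply: measurable_tuple_cons => //.
exact: measurable_half_cube.
Qed.

(** Lindeberg's method: each step trades one uniform variable for the heat flow during
    pi / 6, at the cost 20 / s0^3. The flow starts at time s0^2 instead of 0, where Phi
    is smooth, and H is the room that this needs in the initial comparison. *)
Lemma half_cube_ge sg s0 H k a : sg ^+ 2 = 1 -> 1 <= s0 -> 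
  ((Phi ((a - H) / Num.sqrt (s0 ^+ 2 + k%:R * (pi / 6))))%:E <=
   lebesgue_prod (@half_cube sg k a) + (Phi (- H / s0) + k%:R * (20 / s0 ^+ 3))%:E)%E.
Proof.
move=> sg2 s1; have s0_gt0 : 0 < s0 by lra.
have pi0 := pi_gt0 R.
have s3 : 0 < 20 / s0 ^+ 3 by rewrite divr_gt0 // exprn_gt0.
elim: k a => [|k IH] a.
  (* in dimension 0 the half-cube is the whole point or empty *)
  rewrite !mul0r !addr0 sqrtr_sqr ger0_norm ?(ltW s0_gt0) //.
  have [a0|a0] := leP 0 a.
    have -> : @half_cube sg 0 a = setT.
      by apply/seteqP; split => // x _; split; [by case|by rewrite big_ord0].
    rewrite /= diracT -EFinD lee_fin.
    by apply: (@le_trans _ _ 1); [exact/ltW/Phi_lt1|rewrite lerDl Phi_ge0].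
  apply: (@le_trans _ _ (0 + (Phi (- H / s0))%:E)%E).
    by rewrite add0e lee_fin Phi_mono ler_pM2r ?invr_gt0 // gerDr ltW.
  by rewrite leeD2r // measure_ge0.
set S := Num.sqrt (s0 ^+ 2 + k%:R * (pi / 6)) in IH.
have S0 : s0 <= S.
  rewrite -[leLHS]ger0_norm ?(ltW s0_gt0) // -sqrtr_sqr ler_wsqrtr // lerDl.
  by rewrite mulr_ge0 // divr_ge0 // ltW.
have S1 : 1 <= S by apply: le_trans S0.
have SS : Num.sqrt (s0 ^+ 2 + k.+1%:R * (pi / 6)) = Num.sqrt (S ^+ 2 + pi / 6).
  rewrite sqr_sqrtr; last by rewrite addr_ge0 ?sqr_ge0 // mulr_ge0 // divr_ge0 // ltW.
  by rewrite -natr1 mulrDl mul1r addrA.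
have step := uniform_step (a - H) sg2 S1.
rewrite -SS in step.
set e := Phi (- H / s0) + k%:R * (20 / s0 ^+ 3) in IH.
have e0 : 0 <= e by rewrite addr_ge0 ?Phi_ge0 // mulr_ge0 // ltW.
have -> : Phi (- H / s0) + k.+1%:R * (20 / s0 ^+ 3) = e + 20 / s0 ^+ 3.
  by rewrite -natr1 mulrDl mul1r addrA.
pose q u := Phi ((a - H - sg * (u - 1 / 2)) / S).
have cq : continuous q.
  move=> u; apply: (@continuous_comp _ _ _ (fun u : R => (a - H - sg * (u - 1 / 2)) / S) Phi).
    have h : is_derive u 1 (fun u : R => (a - H - sg * (u - 1 / 2)) / S) (- sg / S).
      by apply: is_derive_eq; rewrite /GRing.scale /=; field; rewrite gt_eqF // (lt_le_trans s0_gt0).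
    exact: is_derive_continuous h.
  exact: continuous_Phi.
have S3 : 20 / S ^+ 3 <= 20 / s0 ^+ 3.
  rewrite ler_pM2l // lef_pV2 ?posrE ?exprn_gt0 ?(lt_le_trans s0_gt0) //.
  by rewrite lerXn2r ?nnegrE ?(ltW s0_gt0) // (le_trans _ S0) // ltW.
have mI : measurable (`]0%R, 1%R[ : set R) by [].
have key : ((\int[lebesgue_measure]_(u in `[0, 1]) q u)%R%:E <=
    lebesgue_prod (@half_cube sg k.+1 a) + e%:E)%E.
  rewrite /Rintegral fineK; last first.
    by apply: integrable_fin_num => //; exact: continuous_integrable_segment.
  rewrite integral_itv_bndoo; last first.
    by apply/measurable_EFinP; apply: measurable_funTS; exact: continuous_measurable_fun.
  have l1 : lebesgue_measure (`]0%R, 1%R[ : set R) = 1%:E.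
    by rewrite lebesgue_measure_itv /= lte_fin ltr01 -EFinB subr0.
  have -> : (e%:E = \int[lebesgue_measure]_(u in `]0%R, 1%R[) (cst e%:E) u)%E.
    by rewrite integral_cst //= l1 mule1.
  apply: (@le_trans _ _ (\int[lebesgue_measure]_(u in `]0%R, 1%R[)
      (section_measure sg k a u + cst e%:E u))%E).
    apply: ge0_le_integral => //.
    - by move=> u _; rewrite lee_fin Phi_ge0.
    - by apply/measurable_EFinP; apply: measurable_funTS; exact: continuous_measurable_fun.
    - by apply: emeasurable_funD => //; apply: measurable_funTS; exact: measurable_section.
    move=> u; rewrite /= in_itv /= => u01; rewrite section_measureE //.
    by have := IH (a - sg * (u - 1 / 2)); rewrite /q addrAC.
  rewrite ge0_integralD //; last by apply: measurable_funTS; exact: measurable_section.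
  rewrite leeD2r // half_cube_measureS; apply: ge0_subset_integral => //.
  exact: measurable_section.
rewrite EFinD addeA; apply: (@le_trans _ _
  ((\int[lebesgue_measure]_(u in `[0, 1]) q u)%R%:E + (20 / s0 ^+ 3)%:E)%E).
  by rewrite -EFinD lee_fin -lerBlDr; apply: le_trans step; rewrite lerB.
by rewrite leeD2r.
Qed.

End half_cube.

(** * Half-cubes as sets far apart *)

Section lower_bound.
Context {R : realType}.

Lemma contraction_continuous (f : R -> R) :
  (forall x y, x <= y -> `|f y - f x| <= y - x) -> continuous f.
Proof.
move=> h x; apply/cvgrPdist_le => e e0; near=> y.
apply: (@le_trans _ _ `|x - y|); last by near: y; exact: cvgr_dist_le.
by case: (leP x y) => [xy|/ltW yx];
  [rewrite distrC [leRHS]distrC|]; rewrite [leRHS]ger0_norm ?subr_ge0 // h.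
Unshelve. all: by end_near. Qed.

Let slab n (c c' : R) : set (n.+1.-tuple R) :=
  [set x | forall i, (if i == ord0 then `]c, c'] else `]0, 1[)%classic (tnth x i)].

Let measurable_slab n c c' : measurable (@slab n c c').
Proof.
have -> : @slab n c c' = \bigcap_(i in [set: 'I_n.+1])
    ((fun x : n.+1.-tuple R => tnth x i) @^-1`
      (if i == ord0 then `]c, c'] else `]0, 1[)%classic).
  by apply/seteqP; split => x /= h i; [move=> _|]; exact: h.
apply: fin_bigcap_measurable => // i _.
rewrite -[X in measurable X]setTI; apply: measurable_tnth => //.
by case: ifP.
Qed.

Let slab_measure n c c' : c <= c' -> lebesgue_prod (@slab n c c') = (c' - c)%:E.
Proof.
move=> cc; have := @lebesgue_prod_box R n.+1
  (fun i => if i == ord0 then `]c, c'] else `]0, 1[)%classic.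
rewrite -/(slab c c') => ->; last by move=> i; case: ifP.
rewrite big_ord_recl /= big1; last first.
  by move=> i _; rewrite /= lebesgue_measure_itv /= lte_fin ltr01 -EFinB subr0.
rewrite mule1 lebesgue_measure_itv /= lte_fin.
case: ifPn => [_|]; first by rewrite EFinB.
by rewrite -leNgt => cc'; rewrite (@le_anti _ _ c c') ?subrr ?cc.
Qed.

(** The measure of the part of A where the first coordinate is at most c is a
    contraction of c. *)
Lemma subset_of_measure n (A : set (n.+1.-tuple R)) (eps : R) :
  measurable A -> A `<=` @unit_cube R n.+1 -> 0 <= eps ->
  (eps%:E <= lebesgue_prod A)%E ->
  exists A', [/\ measurable A', A' `<=` A & lebesgue_prod A' = eps%:E].
Proof.
move=> mA Ac eps0 epsA.
pose C c := A `&` (fun x : n.+1.-tuple R => tnth x ord0) @^-1` `]-oo, c].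
have mC c : measurable (C c).
  apply: measurableI => //.
  by rewrite -[X in measurable X]setTI; apply: measurable_tnth.
have sub c c' : c <= c' -> C c `<=` C c'.
  by move=> cc x [Ax]; rewrite /= in_itv /= => xc; split => //; rewrite /= in_itv /= (le_trans xc).
have cut c c' : c <= c' ->
    (lebesgue_prod (C c') <= lebesgue_prod (C c) + (c' - c)%:E)%E.
  move=> cc; rewrite -(slab_measure n cc).
  apply: le_trans (measureU2 _ (mC c) (@measurable_slab n c c')).
  apply: le_measure; rewrite ?inE;
    [exact: mC|by apply: measurableU; [exact: mC|exact: measurable_slab]|].
  move=> x [Ax]; rewrite /= in_itv /= => xc'.
  have [xc|cx] := leP (tnth x ord0) c.
    by left; split => //; rewrite /= in_itv.
  right => i; case: eqP => [->|_]; first by rewrite /= in_itv /= cx.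
  by rewrite /= in_itv /=; exact: Ac.
have C0 : C 0 = set0.
  apply/seteqP; split => // x [/Ac/(_ ord0)/andP[x0 _]].
  by rewrite /= in_itv /= => /(lt_le_trans x0); rewrite ltxx.
have C1 : C 1 = A.
  apply/seteqP; split => [x []//|x Ax]; split => //.
  by rewrite /= in_itv /=; have /andP[_ /ltW] := Ac _ Ax ord0.
have Cfin c : lebesgue_prod (C c) \is a fin_num.
  rewrite ge0_fin_numE ?measure_ge0 //.
  have [c0|c0] := leP 0 c.
    apply: le_lt_trans (cut 0 c c0) _.
    by rewrite C0 measure0 add0e ltry.
  apply: (@le_lt_trans _ _ (lebesgue_prod (C 0))); last by rewrite C0 measure0.
  by apply: le_measure; rewrite ?inE //; apply: sub; exact: ltW.
pose f c := fine (lebesgue_prod (C c)).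
have fE c : lebesgue_prod (C c) = (f c)%:E by rewrite /f fineK.
have cf : continuous f.
  apply: contraction_continuous => x y xy.
  have := cut _ _ xy; rewrite !fE -EFinD lee_fin => h.
  have : f x <= f y.
    by rewrite -lee_fin -!fE; apply: le_measure; rewrite ?inE //; exact: sub.
  by move=> h'; rewrite ger0_norm ?subr_ge0 // lerBlDl.
have [|||c c01 fc] := @IVT R f 0 1 eps.
- by [].
- exact: continuous_subspaceT.
- have f0 : f 0 = 0 by rewrite /f C0 measure0.
  have f1 : eps <= f 1 by rewrite -lee_fin -fE C1.
  by rewrite f0 min_l ?max_r ?eps0 // (le_trans eps0).
by exists (C c); split; [exact: mC|move=> x []|rewrite fE fc].
Qed.

(** Cauchy-Schwarz against the diagonal vector *)
Lemma half_cube_dist n s (x y : n.-tuple R) : (0 < n)%N ->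
  half_cube 1 (- (s * Num.sqrt n%:R)) x -> half_cube (- 1) (- (s * Num.sqrt n%:R)) y ->
  2 * s <= euclidean_dist x y.
Proof.
move=> n0 [_ hx] [_ hy].
have := cauchy_schwarz (fun i => tnth x i - tnth y i) (fun _ : 'I_n => -1).
have -> : enorm (fun _ : 'I_n => -1 : R) = Num.sqrt n%:R.
  rewrite /enorm (eq_bigr (fun=> 1)); first by rewrite sumr_const card_ord.
  by move=> i _; rewrite sqrrN expr1n.
have -> : \sum_(i < n) (tnth x i - tnth y i) * -1 =
    - (\sum_(i < n) 1 * (tnth x i - 1 / 2)) - \sum_(i < n) (- 1) * (tnth y i - 1 / 2).
  by rewrite -!sumrN -big_split /=; apply: eq_bigr => i _; ring.
move=> h; rewrite -(ler_pM2r (x := Num.sqrt n%:R)) ?sqrtr_gt0 ?ltr0n //.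
by apply: le_trans h; lra.
Qed.

(** In [half_cube_ge] the initial time (t sqrt n)^2 and the shift eta sqrt n have the
    scale of the sum: the smoothing error Phi (- eta / t) is small because t is small
    compared with eta, and n steps cost 20 / (t^3 sqrt n). *)
Lemma half_cube_large (eps s : R) : 0 < eps < 1 -> 0 < s ->
  s < Num.sqrt (pi / 6) * - Phi_inv eps ->
  exists N, forall n sg, (N <= n)%N -> sg ^+ 2 = 1 ->
    (eps%:E <= lebesgue_prod (@half_cube R sg n (- (s * Num.sqrt n%:R))))%E.
Proof.
move=> eps01 s0 sm; have pi0 := pi_gt0 R.
set q := Num.sqrt (pi / 6) in sm.
have q0 : 0 < q by rewrite sqrtr_gt0 divr_gt0.
pose eta := (q * - Phi_inv eps - s) / 2.
have eta0 : 0 < eta by rewrite divr_gt0 // subr_gt0.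
pose P0 := Phi (- ((s + eta) / q)).
have P0e : eps < P0.
  rewrite -[ltLHS](Phi_invK eps01) (leW_mono Phi_mono) ltrNr ltr_pdivrMr // mulrC.
  rewrite /eta; lra.
pose g := P0 - eps; have g0 : 0 < g by rewrite subr_gt0.
have [Y YP] := @Phi_small R (g / 2) ltac:(by rewrite divr_gt0).
have Y1 : 0 < `|Y| + 1 by rewrite ltr_wpDl.
pose t := eta / (`|Y| + 1); have t0 : 0 < t by rewrite divr_gt0.
pose M := t^-1 + 40 / (t ^+ 3 * g).
have t3g : 0 < t ^+ 3 * g by rewrite mulr_gt0 // exprn_gt0.
exists (Num.truncn (M ^+ 2)).+1 => n sg nN sg2.
pose rn : R := Num.sqrt n%:R.
have M0 : 0 < M by rewrite addr_gt0 ?invr_gt0 // divr_gt0.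
have Mr : M <= rn.
  rewrite -[leLHS]ger0_norm ?(ltW M0) // -sqrtr_sqr ler_wsqrtr //.
  by apply: le_trans (ltW (truncnS_gt _)) _; rewrite ler_nat.
have rn0 : 0 < rn by apply: lt_le_trans Mr.
have rn2 : rn ^+ 2 = n%:R by rewrite sqr_sqrtr.
have s01 : 1 <= t * rn.
  rewrite mulrC -ler_pdivrMr // mul1r; apply: le_trans Mr; rewrite lerDl ltW // divr_gt0 //.
have := half_cube_ge (eta * rn) n (- (s * rn)) sg2 s01.
rewrite -leeBlDr // -EFinB; apply: le_trans; rewrite lee_fin.
have B1 : P0 <= Phi ((- (s * rn) - eta * rn) / Num.sqrt ((t * rn) ^+ 2 + n%:R * (pi / 6))).
  set D := Num.sqrt _.
  have D0 : rn * q <= D.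
    rewrite -[leLHS]ger0_norm ?mulr_ge0 ?(ltW rn0) ?(ltW q0) // -sqrtr_sqr ler_wsqrtr //.
    rewrite exprMn rn2 sqr_sqrtr ?(ltW (divr_gt0 _ _)) // lerDr sqr_ge0 //.
  have D1 : 0 < D by apply: lt_le_trans D0; rewrite mulr_gt0.
  rewrite Phi_mono -opprD -mulrDl mulNr lerN2 ler_pdivrMr // -mulrA.
  rewrite ler_wpM2l ?addr_ge0 ?(ltW s0) ?(ltW eta0) // mulrC ler_pdivlMr //.
have B2 : Phi (- (eta * rn) / (t * rn)) <= g / 2.
  apply: le_trans (ltW YP); rewrite Phi_mono mulNr -mulf_div mulfV ?gt_eqF // mulr1.
  have -> : eta / t = `|Y| + 1 by rewrite /t invf_div mulrCA mulfV ?mulr1 ?gt_eqF.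
  have := ler_norm (- Y); rewrite normrN; lra.
have B3 : n%:R * (20 / (t * rn) ^+ 3) <= g / 2.
  have -> : n%:R * (20 / (t * rn) ^+ 3) = 20 / (t ^+ 3) / rn.
    by rewrite -rn2; field; rewrite !gt_eqF.
  rewrite ler_pdivrMr // -ler_pdivrMl ?divr_gt0 //.
  apply: le_trans Mr; rewrite /M.
  have -> : (g / 2)^-1 * (20 / t ^+ 3) = 40 / (t ^+ 3 * g) by field; rewrite !gt_eqF.
  by rewrite lerDr invr_ge0 ltW.
rewrite /g in B2 B3; lra.
Qed.

Lemma cube_dist_ge n (eps s : R) : (0 < n)%N -> 0 < eps ->
  (forall sg, sg ^+ 2 = 1 ->
    (eps%:E <= lebesgue_prod (@half_cube R sg n (- (s * Num.sqrt n%:R))))%E) ->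
  ((2 * s)%:E <= cube_dist eps n)%E.
Proof.
case: n => // n _ eps0 large; set a := - (s * _) in large.
have pick sg : sg ^+ 2 = 1 -> exists A, [/\ A `<=` @half_cube R sg n.+1 a,
    A `<=` @unit_cube R n.+1, lebesgue_measurable A & volume A = eps%:E].
  move=> /large l.
  have [|A [mA Ah vA]] := subset_of_measure (measurable_half_cube sg a) _ (ltW eps0) l.
    by move=> x [].
  have [lA vE] := lebesgue_measurable_borel mA.
  by exists A; split => //; [move=> x /Ah[]|rewrite vE].
have [A [Ah Ac lA vA]] := pick 1 (expr1n _ _).
have [|B [Bh Bc lB vB]] := pick (- 1); first by rewrite sqrrN expr1n.
apply: le_ereal_sup_tmp; exists (set_dist A B); first by exists (A, B).
apply: le_ereal_inf_tmp => _ [[x y] /= [Ax By] <-]; rewrite lee_fin.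
by apply: half_cube_dist => //; [exact: Ah|exact: Bh].
Qed.

End lower_bound.

(** * The limits *)

Lemma limn_esup_le_ub (R : realType) (u : (\bar R)^nat) (l : \bar R) :
  (forall n, (u n <= l)%E) -> (limn_esup u <= l)%E.
Proof.
move=> ul; rewrite limn_esup_lim (cvg_lim (@ereal_hausdorff R) (@cvg_esups_inf R u)).
apply: (@le_trans _ _ (esups u 0)); first by apply: ereal_inf_lbound; exists 0%N.
by apply: ge_ereal_sup => _ [n _ <-].
Qed.

Lemma limn_einf_ge_lb (R : realType) (u : (\bar R)^nat) (l : \bar R) N :
  (forall n, (N <= n)%N -> (l <= u n)%E) -> (l <= limn_einf u)%E.
Proof.
move=> lu; rewrite limn_einf_lim (cvg_lim (@ereal_hausdorff R) (@cvg_einfs_sup R u)).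
apply: (@le_trans _ _ (einfs u N)); last by apply: ereal_sup_ubound; exists N.
by apply: le_ereal_inf_tmp => _ [n Nn <-]; exact: lu.
Qed.

Lemma cube_dist_le (R : realType) (eps : R) n : 0 < eps < 1 / 2 ->
  (cube_dist eps n <= (- 2 * Phi_inv eps)%:E)%E.
Proof.
move=> eps12; apply: ge_ereal_sup => _ [[A B] /= [Ac Bc _ _ [vA vB]] <-].
rewrite leNgt; apply/negP => h.
have [d dl dh] : exists2 d : R, - 2 * Phi_inv eps < d & (d%:E <= set_dist A B)%E.
  case E : (set_dist A B) h => [r| |] // h.
    by exists r => //; rewrite -lte_fin.
  by exists (- 2 * Phi_inv eps + 1); [rewrite ltrDl|exact: leey].
suff : d <= - 2 * Phi_inv eps by rewrite leNgt dl.
apply: (separated_sets_le eps12 Ac Bc vA vB) => x y Ax By.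
rewrite -lee_fin; apply: le_trans dh _; apply: ereal_inf_lbound.
by exists (x, y).
Qed.

Theorem mainTheorem2 (R : realType) (eps : R) (eps_gt0 : 0 < eps)
    (eps_lt : eps < 1 / 2) :
  [/\ ((- 2 * Num.sqrt (pi / 6) * Phi_inv eps)%:E
         <= limn_einf (cube_dist eps))%E,
      (limn_einf (cube_dist eps) <= limn_esup (cube_dist eps))%E
    & (limn_esup (cube_dist eps) <= (- 2 * Phi_inv eps)%:E)%E].
Proof.
have eps01 : 0 < eps < 1 by rewrite eps_gt0; lra.
split; [|exact: limn_einf_sup|]; last first.
  by apply: limn_esup_le_ub => n; apply: cube_dist_le; rewrite eps_gt0.
have y0 : Phi_inv eps < 0.
  rewrite -Phi_inv_half ltNge Phi_inv_le ?invr_gt0 ?ltr0n //= -?ltNge; lra.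
have q0 : 0 < Num.sqrt (pi / 6) :> R by rewrite sqrtr_gt0 divr_gt0 ?pi_gt0.
pose b := Num.sqrt (pi / 6) * - Phi_inv eps.
have b0 : 0 < b by rewrite mulr_gt0 ?oppr_gt0.
have -> : - 2 * Num.sqrt (pi / 6) * Phi_inv eps = 2 * b by rewrite /b; ring.
apply/lee_subgt0Pr => e e0.
(* s is less than b, positive, and 2 s is within e of 2 b *)
pose s := Num.max (b / 2) (b - e / 2).
have s0 : 0 < s by rewrite lt_max divr_gt0.
have sb : s < b by rewrite gt_max; lra.
have [N NP] := half_cube_large eps01 s0 sb.
apply: (@le_trans _ _ (2 * s)%:E).
  have : b - e / 2 <= s by rewrite le_max lexx orbT.
  rewrite -EFinB lee_fin; lra.
apply: (@limn_einf_ge_lb _ _ _ N.+1) => n nN.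
by apply: cube_dist_ge => // [|sg sg2]; [exact: leq_ltn_trans nN|apply: NP => //; exact: ltnW].
Qed.
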